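(* Let $(\mathcal{X},\mathcal{Y},\ell,S)$ be a Blackwell instance such that $\mathcal{X}\subset\mathbb{R}^n_+$, $\mathcal{Y}\subset\mathbb{R}^m_+$, $S\subset\mathbb{R}^d$ is compact and approachable, and $\ell(x,y)\ge 0$ coordinate-wise for all $(x,y)\in\mathbb{R}^n_+\times\mathbb{R}^m_+$. 1. (a) Suppose the player's set $\mathcal{X}$ is accessible through an approximation oracle with ratio $\alpha_{\mathcal{X}}\ge 1$ (with no restriction on $\mathcal{Y}$). Then $(\alpha_{\mathcal{X}}S)_{\downarrow}$ is approachable. In particular, there is an algorithm with approachability rate $O(1/\sqrt{T})$ to $(\alpha_{\mathcal{X}}S)_{\downarrow}$ which requires a total number of $O(T^2)$ calls to the approximation oracle of $\mathcal{X}$. (b) Alternatively, suppose the adversary's set $\mathcal{Y}$ is accessible through an approximation oracle with ratio $0<\alpha_{\mathcal{Y}}\le 1$ (with no restriction on $\mathcal{X}$). Then $(\alpha_{\mathcal{Y}}^{-1}S)_{\downarrow}$ is approachable. In particular, there is an algorithm with approachability rate $O(1/\sqrt{T})$ to $(\alpha_{\mathcal{Y}}^{-1}S)_{\downarrow}$ which requires a total number of $O(T^2)$ calls to the approximation oracle of $\mathcal{Y}$. 2. Suppose both $\mathcal{X}$ and $\mathcal{Y}$ are accessible through approximation oracles with ratios $\alpha_{\mathcal{X}}\ge 1$ and $0<\alpha_{\mathcal{Y}}\le 1$, respectively. Then $(\alpha_{\mathcal{X}}\alpha_{\mathcal{Y}}^{-1}S)_{\downarrow}$ is approachable. In particular,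 there is an algorithm with approachability rate $O(1/\sqrt{T})$ to $(\alpha_{\mathcal{X}}\alpha_{\mathcal{Y}}^{-1}S)_{\downarrow}$ which requires a total number of $O(T^3)$ calls to the approximation oracle of $\mathcal{X}$ and $O(T^2)$ calls to the approximation oracle of $\mathcal{Y}$.
   Context: **Blackwell instance.** A tuple $(\mathcal{X},\mathcal{Y},\ell,S)$ where $\mathcal{X}\subset\mathbb{R}^n$ (player's actions) and $\mathcal{Y}\subset\mathbb{R}^m$ (adversary's actions) are nonempty, convex and compact, $S\subset\mathbb{R}^d$ is nonempty, convex and closed, and $\ell:\mathbb{R}^n\times\mathbb{R}^m\to\mathbb{R}^d$ is bilinear. **Approachability.** With $d(\cdot,\cdot)$ the Euclidean distance from a point to a set, a set $Q\subset\mathbb{R}^d$ is approachable if there is an algorithm $\mathcal{A}$ selecting $x_t=\mathcal{A}(y_1,\dots,y_{t-1})\in\mathcal{X}$ such that for every sequence $(y_t)_{t\ge1}\subseteq\mathcal{Y}$, $d\big(\frac1T\sum_{t=1}^T\ell(x_t,y_t),Q\big)\to0$ as $T\to\infty$. **Downward closure and scaling.** $(K)_{\downarrow}=\{y\in\mathbb{R}^d:\exists x\in K,\ y\le x\}$ (coordinate-wise order), and $\beta S=\{\beta s:s\in S\}$. **Approximation oracles.** An approximation oracle for $\mathcal{X}\subset\mathbb{R}^n_+$ with ratio $\alpha_{\mathcal{X}}\ge1$ is a map $\mathcal{O}_{\mathcal{X}}$ such that for every $c\in\mathbb{R}^n_+$, $\mathcal{O}_{\mathcal{X}}(c)\in\mathcal{X}$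 and $\langle\mathcal{O}_{\mathcal{X}}(c),c\rangle\le\alpha_{\mathcal{X}}\min_{x\in\mathcal{X}}\langle x,c\rangle$. An approximation oracle for $\mathcal{Y}\subset\mathbb{R}^m_+$ with ratio $0<\alpha_{\mathcal{Y}}\le1$ is a map $\mathcal{O}_{\mathcal{Y}}$ such that for every $c\in\mathbb{R}^m_+$, $\mathcal{O}_{\mathcal{Y}}(c)\in\mathcal{Y}$ and $\langle\mathcal{O}_{\mathcal{Y}}(c),c\rangle\ge\alpha_{\mathcal{Y}}\max_{y\in\mathcal{Y}}\langle y,c\rangle$. **Access model.** The algorithms (including those witnessing approachability) know $\ell$, the ratios, and upper bounds $R_{\mathcal{X}}\ge\max_{x\in\mathcal{X}}\|x\|$, $R_{\mathcal{Y}}\ge\max_{y\in\mathcal{Y}}\|y\|$ and upper bounds on the diameters of $\mathcal{X},\mathcal{Y}$. A set ''accessible through an approximation oracle'' can be accessed only by querying its oracle at nonnegative vectors (and by taking convex combinations of returned points and so on). A set with ''no restriction'' is one for which Euclidean projections can be computed. The set $S$ is accessed through an exact linear optimization oracle, giving the support function $h_S(w)=\sup_{s\in S}\langle w,s\rangle$ and its subgradients. The algorithm observes the adversary's action $y_t$ at the end of each round $t$. **Rate and number of calls.** The horizon $T$ is finite and known in advance. ''Approachability rate $O(1/\sqrt T)$ to $Q$ with $O(T^k)$ calls'' means: there is a constant $C$, depending on the instance and oracle ratios but not on $T$ or on the adversary's choices, such that for every $T\ge1$ the algorithm run with horizon $T$ plays $x_1,\dots,x_T\in\mathcal{X}$ satisfying,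 for every choice of $y_1,\dots,y_T\in\mathcal{Y}$, $d\big(\frac1T\sum_{t=1}^T\ell(x_t,y_t),Q\big)\le C/\sqrt T$, and makes at most $CT^k$ calls to the oracle in question over all $T$ rounds. *)

(* Defs.v *)
From HB Require Import structures.
From mathcomp Require Import all_boot all_order all_algebra.
From mathcomp Require Import all_classical all_reals all_analysis.
Set Implicit Arguments.
Unset Strict Implicit.
Unset Printing Implicit Defensive.
Import Order.TTheory GRing.Theory Num.Theory.
Import numFieldNormedType.Exports.
Local Open Scope classical_set_scope.
Local Open Scope ring_scope.

Section Euclidean.
Context {R : realType} {n : nat}.
Implicit Types (u v w : 'rV[R]_n) (K : set 'rV[R]_n).

Definition dotv u v : R := \sum_(i < n) u 0 i * v 0 i.

(* The norm of the library's normed module structure on ['rV[R]_n] is the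
   sup norm, hence this separate Euclidean norm. *)
Definition enorm u : R := Num.sqrt (dotv u u).

Definition distance v K : R := inf [set enorm (v - q) | q in K].

Definition lev u v : bool := [forall i, u 0 i <= v 0 i].

Definition dclosure K : set 'rV[R]_n := [set y | exists2 x, K x & lev y x].

Definition dilate (b : R) K : set 'rV[R]_n := [set b *: s | s in K].

Definition support_function K w : R := sup [set dotv w s | s in K].

End Euclidean.

Definition orthant (R : realType) (n : nat) : Type := {c : 'rV[R]_n | lev 0 c}.

Section Oracles.
Context {R : realType} {n : nat}.
Implicit Types K : set 'rV[R]_n.

(* The sets are compact wherever these are used, so that [inf] and [sup] are a
   minimum and a maximum. *)
Definition approx_min_oracle (alpha : R) K (O : orthant R n -> 'rV[R]_n) :=
  forall c : orthant R n, K (O c) /\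
    dotv (O c) (val c) <= alpha * inf [set dotv x (val c) | x in K].

Definition approx_max_oracle (alpha : R) K (O : orthant R n -> 'rV[R]_n) :=
  forall c : orthant R n, K (O c) /\
    dotv (O c) (val c) >= alpha * sup [set dotv y (val c) | y in K].

Definition projection_oracle K (P : 'rV[R]_n -> 'rV[R]_n) :=
  forall v, K (P v) /\ enorm (v - P v) = distance v K.

(* The answer to [w] is a maximizer of [dotv w] over [K], that is a subgradient
   at [w] of the support function; the value of the latter is [dotv w (O w)]. *)
Definition linear_oracle K (O : 'rV[R]_n -> 'rV[R]_n) :=
  forall w, K (O w) /\ dotv w (O w) = support_function K w.

End Oracles.

Section Game.
Context {R : realType} {n m d : nat}.
Variable ell : 'rV[R]_n -> 'rV[R]_m -> 'rV[R]_d.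
Implicit Types (X : set 'rV[R]_n) (Y : set 'rV[R]_m) (S Q : set 'rV[R]_d).
Implicit Types (A : seq 'rV[R]_m -> 'rV[R]_n) (y : nat -> 'rV[R]_m).

(* Rounds are numbered from 0: in round [t] the player answers
   [A [:: y 0; ...; y (t - 1)]] and the adversary plays [y t]. *)
Definition average_payoff A y (T : nat) : 'rV[R]_d :=
  T%:R^-1 *: \sum_(t < T) ell (A (mkseq y t)) (y t).

Definition approaches X Y A Q : Prop :=
  forall y, (forall t, Y (y t)) ->
    (forall t, X (A (mkseq y t))) /\
    (fun T : nat => distance (average_payoff A y T) Q) @ \oo --> (0 : R).

Definition approachable X Y Q : Prop := exists A, approaches X Y A Q.

Record blackwell_instance X Y S : Prop := {
  player_nonempty : X !=set0;
  player_convex : convex_set X;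
  player_compact : compact X;
  adversary_nonempty : Y !=set0;
  adversary_convex : convex_set Y;
  adversary_compact : compact Y;
  target_nonempty : S !=set0;
  target_convex : convex_set S;
  target_closed : closed S }.

Record positive_instance X Y S : Prop := {
  positive_blackwell : blackwell_instance X Y S;
  player_ge0 : X `<=` [set x | lev 0 x];
  adversary_ge0 : Y `<=` [set y | lev 0 y];
  target_compact : compact S;
  target_approachable : approachable X Y S }.

End Game.

Definition bounded_by (R : realType) (n : nat) (r D : R) (K : set 'rV[R]_n) :=
  (forall x, K x -> enorm x <= r) /\
  (forall x x', K x -> K x' -> enorm (x - x') <= D).

(* A deterministic computation that may query the oracles of the player's set,
   of the adversary's set and of the target set, and does not see these sets
   otherwise. [QX] and [QY] are the types of the admissible queries: [orthant]
   for approximation oracles, all vectors for projections. Computations are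
   well-founded trees, so each of them makes finitely many queries. *)
Inductive computation (R : realType) (n m d : nat) (QX QY A : Type) : Type :=
| Return of A
| AskX of QX & ('rV[R]_n -> computation R n m d QX QY A)
| AskY of QY & ('rV[R]_m -> computation R n m d QX QY A)
| AskS of 'rV[R]_d & ('rV[R]_d -> computation R n m d QX QY A).

Arguments Return {R n m d QX QY A}.

Record oracles (R : realType) (n m d : nat) (QX QY : Type) := Oracles {
  oracleX : QX -> 'rV[R]_n;
  oracleY : QY -> 'rV[R]_m;
  oracleS : 'rV[R]_d -> 'rV[R]_d }.

(* In each round the algorithm computes an action and an updated memory, then
   stores the adversary's action. *)
Record algorithm (R : realType) (n m d : nat) (QX QY : Type) := Algorithm {
  memory : Type;
  initial : memory;
  choose : memory -> computation R n m d QX QY (memory * 'rV[R]_n);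
  observe : memory -> 'rV[R]_m -> memory }.

Section Execution.
Context {R : realType} {n m d : nat} {QX QY : Type}.
Variable O : oracles R n m d QX QY.

Fixpoint result A (p : computation R n m d QX QY A) : A :=
  match p with
  | Return a => a
  | AskX q k => result (k (oracleX O q))
  | AskY q k => result (k (oracleY O q))
  | AskS w k => result (k (oracleS O w))
  end.

Fixpoint queriesX A (p : computation R n m d QX QY A) : nat :=
  match p with
  | Return _ => 0
  | AskX q k => (queriesX (k (oracleX O q))).+1
  | AskY q k => queriesX (k (oracleY O q))
  | AskS w k => queriesX (k (oracleS O w))
  end.

Fixpoint queriesY A (p : computation R n m d QX QY A) : nat :=
  match p with
  | Return _ => 0
  | AskX q k => queriesY (k (oracleX O q))
  | AskY q k => (queriesY (k (oracleY O q))).+1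
  | AskS w k => queriesY (k (oracleS O w))
  end.

Variable alg : algorithm R n m d QX QY.

Definition memory_after (ys : seq 'rV[R]_m) : memory alg :=
  foldl (fun mu y => observe (result (choose mu)).1 y) (initial alg) ys.

Definition selection (ys : seq 'rV[R]_m) : 'rV[R]_n :=
  (result (choose (memory_after ys))).2.

Definition callsX (y : nat -> 'rV[R]_m) (T : nat) : nat :=
  (\sum_(t < T) queriesX (choose (memory_after (mkseq y t))))%N.

Definition callsY (y : nat -> 'rV[R]_m) (T : nat) : nat :=
  (\sum_(t < T) queriesY (choose (memory_after (mkseq y t))))%N.

End Execution.

Definition within_rate (R : realType) (n m d : nat)
    (ell : 'rV[R]_n -> 'rV[R]_m -> 'rV[R]_d) (X : set 'rV[R]_n)
    (Q : set 'rV[R]_d) (C : R) (T : nat) (A : seq 'rV[R]_m -> 'rV[R]_n)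
    (y : nat -> 'rV[R]_m) : Prop :=
  (forall t, (t < T)%N -> X (A (mkseq y t))) /\
  distance (average_payoff ell A y T) Q <= C / Num.sqrt T%:R.

(* Main.v *)
Require Import Defs.
From HB Require Import structures.
From mathcomp Require Import all_boot all_order all_algebra.
From mathcomp Require Import all_classical all_reals all_analysis.
From mathcomp Require Import ring lra.
Set Implicit Arguments.
Unset Strict Implicit.
Unset Printing Implicit Defensive.
Import Order.TTheory GRing.Theory Num.Theory.
Import numFieldNormedType.Exports.
Local Open Scope classical_set_scope.
Local Open Scope ring_scope.

(** Blackwell's strategy steers the drift [D], the sum over the past rounds of
    the payoffs minus points of the scaled target [beta S]. Only the positive
    part of [D] matters for the distance to the downward closure. If in each
    round the action [x] satisfies
<<
      <w, ell x y> <= beta h_S(w) + e    for all y in Y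
>>
    where [w] is the unit vector along the positive part of [D] and [h_S] the
    support function of [S], then the new increment makes an almost obtuse
    angle with [w] and the length of the positive part grows by Pythagoras only
    ([pospart_growth]). With [e] of order [1 / sqrt t] in round [t] it stays of
    order [sqrt T], which is the rate ([blackwell_within_rate]). The algorithm
    does not depend on the horizon, so it also approaches the set.

    It remains to find such an action within a budget of queries. An exact one
    exists for [beta = 1] because [S] is approachable ([halfspace_response]);
    call it [u]. Since [ell] is nonnegative, the linear functions of [x] and of
    [y] that the direction [w >= 0] induces are admissible queries. Round [t]
    uses [K = t + 1] inner iterations, so that errors of order [1 / sqrt K] are
    affordable and the sum of [K] over the rounds is of order [T ^ 2].

    - Approximation oracle for [X], projections onto [Y]: an imaginary adversary
      runs online gradient ascent in [Y] while the oracle of [X] answers it.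
      Each answer costs at most [alphaX] times the payoff of [u], hence at most
      [alphaX h_S(w)], and the average answer is good against all of [Y] by the
      regret bound ([gradient_responderP]).

    - Approximation oracle for [Y]: an iterate [z], possibly outside of [X],
      moves towards the unknown point [alphaX u] ([descent_responderP]). In each
      iteration either a point [x] of [X] is found that [z] almost dominates, or
      a hyperplane is found that separates [z] from [alphaX X] with a margin of
      order [1 / sqrt K]. In the first case the oracle of [Y] is asked for a
      response to [x]; either the response certifies that [x] is good against
      all of [Y], up to the factor [alphaY ^-1], or it separates [z] from
      [alphaX u] with the same margin. Each separation decreases the squared
      distance from [z] to [alphaX u] by more than a [K]-th part of the bound on
      its initial value, so fewer than [K] of them occur. To locate [z] with
      respect to [X], one projection suffices ([projection_locateP]); with an
      approximation oracle it takes [K] queries ([perceptron_locateP]), by the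
      growth estimate that drives the outer strategy. This makes [K ^ 2] queries
      to [X] in a round, of order [T ^ 3] in total. *)

(** * Euclidean geometry of row vectors *)

Section EuclideanGeometry.
Context {R : realType} {n : nat}.
Implicit Types (u v w x z : 'rV[R]_n) (a b : R) (K : set 'rV[R]_n).

Lemma dotvC u v : dotv u v = dotv v u.
Proof. by apply: eq_bigr => i _; rewrite mulrC. Qed.

Lemma dotvDl u v w : dotv (u + v) w = dotv u w + dotv v w.
Proof.
by rewrite -big_split; apply: eq_bigr => i _ /=; rewrite !mxE mulrDl.
Qed.

Lemma dotvZl a u v : dotv (a *: u) v = a * dotv u v.
Proof. by rewrite big_distrr; apply: eq_bigr => i _; rewrite /= mxE mulrA. Qed.

Lemma dotvNl u v : dotv (- u) v = - dotv u v.
Proof. by rewrite -scaleN1r dotvZl mulN1r. Qed.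

Lemma dotvDr u v w : dotv w (u + v) = dotv w u + dotv w v.
Proof. by rewrite dotvC dotvDl !(dotvC _ w). Qed.

Lemma dotvZr a u v : dotv v (a *: u) = a * dotv v u.
Proof. by rewrite dotvC dotvZl dotvC. Qed.

Lemma dotvNr u v : dotv v (- u) = - dotv v u.
Proof. by rewrite dotvC dotvNl dotvC. Qed.

Definition dotvE := (dotvDl, dotvDr, dotvNl, dotvNr, dotvZl, dotvZr).

Lemma dotv_sqr_step a u v : dotv (u - a *: v) (u - a *: v) =
  dotv u u - 2 * a * dotv u v + a ^+ 2 * dotv v v.
Proof. by rewrite !dotvE (dotvC v u); ring. Qed.

Lemma dotv0l u : dotv 0 u = 0.
Proof. by rewrite -(scale0r 0) dotvZl mul0r. Qed.

Lemma dotv_suml I (r : seq I) (F : I -> 'rV[R]_n) u :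
  dotv (\sum_(i <- r) F i) u = \sum_(i <- r) dotv (F i) u.
Proof. by elim/big_rec2: _ => [|i ? ? _ <-]; rewrite ?dotv0l ?dotvDl. Qed.

Lemma dotvv_ge0 u : 0 <= dotv u u.
Proof. by apply: sumr_ge0 => i _; rewrite -expr2 sqr_ge0. Qed.

Lemma dotv_ge0 u v : lev 0 u -> lev 0 v -> 0 <= dotv u v.
Proof.
move=> /forallP u0 /forallP v0; apply: sumr_ge0 => i _.
by apply: mulr_ge0; [have := u0 i | have := v0 i]; rewrite mxE.
Qed.

Lemma enorm_ge0 u : 0 <= enorm u.
Proof. exact: sqrtr_ge0. Qed.

Lemma enorm_sqr u : enorm u ^+ 2 = dotv u u.
Proof. by rewrite sqr_sqrtr ?dotvv_ge0. Qed.

Lemma enorm_le u a : 0 <= a -> (enorm u <= a) = (dotv u u <= a ^+ 2).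
Proof. by move=> a0; rewrite -enorm_sqr ler_pXn2r ?nnegrE ?enorm_ge0. Qed.

Lemma enorm_eq0 u : enorm u = 0 -> u = 0.
Proof.
move=> u0; apply/rowP => i; rewrite mxE; apply/eqP; rewrite -sqrf_eq0 expr2.
have := enorm_sqr u; rewrite u0 expr0n => /esym/psumr_eq0P -> //.
by move=> j _; rewrite -expr2 sqr_ge0.
Qed.

Lemma enorm0 : enorm (0 : 'rV[R]_n) = 0.
Proof. by rewrite /enorm dotv0l sqrtr0. Qed.

Lemma enormZ a u : enorm (a *: u) = `|a| * enorm u.
Proof. by rewrite /enorm !dotvE mulrA -expr2 sqrtrM ?sqr_ge0// sqrtr_sqr. Qed.

Lemma enormN u : enorm (- u) = enorm u.
Proof. by rewrite -scaleN1r enormZ normrN1 mul1r. Qed.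

Lemma cauchy_schwarz u v : dotv u v <= enorm u * enorm v.
Proof.
have [uv0|uv0] := eqVneq (enorm u * enorm v) 0.
  have /orP[] : (enorm u == 0) || (enorm v == 0) by rewrite -mulf_eq0 uv0.
    by move=> /eqP/enorm_eq0 ->; rewrite dotv0l enorm0 mul0r.
  by move=> /eqP/enorm_eq0 ->; rewrite dotvC dotv0l enorm0 mulr0.
have uv_gt0 : 0 < enorm u * enorm v by rewrite lt0r uv0 mulr_ge0 ?enorm_ge0.
have := dotvv_ge0 (enorm v *: u - enorm u *: v).
rewrite !dotvE -!enorm_sqr (dotvC v u) => h.
rewrite -(ler_pM2l uv_gt0); move: h.
by move: (enorm u) (enorm v) (dotv u v) => p q s h; lra.
Qed.

Lemma enormD u v : enorm (u + v) <= enorm u + enorm v.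
Proof.
rewrite enorm_le ?addr_ge0 ?enorm_ge0// !dotvE (dotvC v u) -!enorm_sqr.
by have := cauchy_schwarz u v; nra.
Qed.

Lemma enormB u v : enorm (u - v) <= enorm u + enorm v.
Proof. by rewrite -(enormN v) enormD. Qed.

Lemma norm_coord_le u i : `|u 0 i| <= enorm u.
Proof.
rewrite -sqrtr_sqr /enorm ler_sqrt ?dotvv_ge0// /dotv (bigD1 i) //= expr2 lerDl.
by apply: sumr_ge0 => j _; rewrite -expr2 sqr_ge0.
Qed.

Lemma enorm_le_sum u : enorm u <= \sum_i `|u 0 i|.
Proof.
rewrite enorm_le ?sumr_ge0// /dotv expr2 big_distrl /=; apply: ler_sum => i _.
rewrite (le_trans (ler_norm _))// normrM ler_wpM2l// (bigD1 i)//= lerDl.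
exact: sumr_ge0.
Qed.

Lemma distance_le v q K : K q -> distance v K <= enorm (v - q).
Proof.
move=> Kq; apply: ge_inf; last by exists q.
by exists 0 => _ [p _ <-]; exact: enorm_ge0.
Qed.

Lemma distance_ge0 v K : 0 <= distance v K.
Proof.
have [->|/set0P[q Kq]] := eqVneq K set0.
  by rewrite /distance image_set0 inf0.
apply: lb_le_inf; first by exists (enorm (v - q)), q.
by move=> _ [p _ <-]; exact: enorm_ge0.
Qed.

Lemma continuous_dotv (T : topologicalType) (f g : T -> 'rV[R]_n) :
  continuous f -> continuous g -> continuous (fun t => dotv (f t) (g t)).
Proof.
move=> cf cg; apply: continuous_big; first exact: add_continuous.
move=> i _ t; apply: cvgM.
  exact: (continuous_comp (cf t) (@coord_continuous _ _ _ 0 i _)).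
exact: (continuous_comp (cg t) (@coord_continuous _ _ _ 0 i _)).
Qed.

Lemma compact_enorm_bounded K : compact K ->
  exists B : R, forall v, K v -> enorm v <= B.
Proof.
have [->|/set0P K0 cK] := eqVneq K set0; first by exists 0.
have /(compact_EVT_max K0 cK)[c _ cmax] :
    {within K, continuous (fun v => dotv v v)}.
  by apply: continuous_subspaceT; apply: continuous_dotv => v; exact: cvg_id.
exists (enorm c) => v /mem_set /cmax.
by rewrite enorm_le ?enorm_ge0// enorm_sqr.
Qed.

Lemma le_support (S : set 'rV[R]_n) w s :
  compact S -> S s -> dotv w s <= support_function S w.
Proof.
move=> cS Ss; have [B SB] := compact_enorm_bounded cS.
apply: ub_le_sup; last by exists s.
exists (enorm w * B) => _ [v Sv <-].
by apply: le_trans (cauchy_schwarz _ _) _; rewrite ler_wpM2l ?enorm_ge0 ?SB.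
Qed.

(** ** Convex sets *)

Lemma convex_setP K u v a : convex_set K -> K u -> K v -> 0 <= a <= 1 ->
  K (a *: u + (1 - a) *: v).
Proof.
move=> cK Ku Kv /andP[a0 a1].
by have := cK u v (Itv01 a0 a1) (mem_set Ku) (mem_set Kv) => /set_mem.
Qed.

(** Membership of an average of [k] points, cleared of its denominator so that
    it can be propagated one point at a time. *)
Lemma dilate_addr K (k : nat) u v :
  convex_set K -> dilate k%:R K u -> K v -> dilate k.+1%:R K (u + v).
Proof.
move=> cK [x Kx <-] Kv.
have k0 : (k.+1%:R : R) != 0 by rewrite pnatr_eq0.
exists ((k%:R / k.+1%:R) *: x + (1 - k%:R / k.+1%:R) *: v).
  apply: convex_setP => //; rewrite divr_ge0//= ler_pdivrMr// mul1r.
  by rewrite ler_nat.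
rewrite scalerDr !scalerA mulrBr mulr1 mulrCA divff// mulr1.
by rewrite -natrB// subSn// subnn scale1r.
Qed.

Lemma dilate0 K : K !=set0 -> dilate 0 K 0.
Proof. by move=> [x Kx]; exists x => //; rewrite scale0r. Qed.

Lemma dilate_mean K (k : nat) u :
  (0 < k)%N -> dilate k%:R K u -> K (k%:R^-1 *: u).
Proof.
by move=> k0 [x Kx <-]; rewrite scalerA mulVf ?scale1r// pnatr_eq0 -lt0n.
Qed.

(** The variational inequality of the nearest point: moving from it towards a
    point of the convex set cannot decrease the distance, to first order. *)
Lemma nearest_obtuse K v p : convex_set K -> K p ->
  enorm (v - p) = distance v K -> forall u, K u -> dotv (v - p) (u - p) <= 0.
Proof.
move=> cK Kp vp u Ku; rewrite leNgt; apply/negP => a_gt0.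
set a := dotv (v - p) (u - p) in a_gt0.
set b := dotv (u - p) (u - p); have b_ge0 : 0 <= b := dotvv_ge0 _.
have ab_gt0 : 0 < a + b by rewrite ltr_pwDl.
pose l := a / (a + b).
have l_gt0 : 0 < l by rewrite divr_gt0.
have l01 : 0 <= l <= 1 by rewrite ltW//= ler_pdivrMr// mul1r lerDl.
have := distance_le v (convex_setP cK Ku Kp l01); rewrite -vp.
have -> : v - (l *: u + (1 - l) *: p) = (v - p) - l *: (u - p).
  by apply/rowP => i; rewrite !mxE; ring.
rewrite enorm_le ?enorm_ge0// enorm_sqr.
rewrite dotv_sqr_step -/a -/b => h.
have : l * (2 * a) <= l * (l * b) by lra.
rewrite ler_pM2l// mulrAC ler_pdivlMr//; nra.
Qed.

(** The angle at the nearest point of a convex set is obtuse, so the side opposite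
    to it is the longest of the triangle. *)
Lemma projection_closer K P v u : convex_set K -> projection_oracle K P ->
  K u -> dotv (P v - u) (P v - u) <= dotv (v - u) (v - u).
Proof.
move=> cK KP Ku; have [KPv vP] := KP v.
have := nearest_obtuse cK KPv vP Ku; have := dotvv_ge0 (v - P v).
have -> : v - u = (P v - u) - (-1) *: (v - P v).
  by apply/rowP => i; rewrite !mxE; ring.
rewrite dotv_sqr_step -(opprB (P v) u) dotvNr (dotvC (v - P v)); lra.
Qed.

End EuclideanGeometry.

(** * Positive parts and the growth of a steered sum *)

Section PositivePart.
Context {R : realType} {n : nat}.
Implicit Types (u v w g : 'rV[R]_n) (a e G : R).

Definition pospart v : 'rV[R]_n := \row_i Num.max (v 0 i) 0.

Lemma pospart_ge0 v : lev 0 (pospart v).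
Proof. by apply/forallP => i; rewrite !mxE le_max lexx orbT. Qed.

Lemma lev_pospart v : lev v (pospart v).
Proof. by apply/forallP => i; rewrite !mxE le_max lexx. Qed.

Lemma pospart_id v : lev 0 v -> pospart v = v.
Proof.
move=> /forallP v0; apply/rowP => i; rewrite mxE; apply/max_idPl.
by have := v0 i; rewrite mxE.
Qed.

Lemma pospart0 : pospart 0 = 0.
Proof. by apply: pospart_id; apply/forallP. Qed.

Lemma dotv_le_pospart v w : lev 0 w -> dotv v w <= enorm (pospart v) * enorm w.
Proof.
move=> /forallP w0; apply: le_trans (cauchy_schwarz _ _).
apply: ler_sum => i _; rewrite ler_wpM2r//; first by have := w0 i; rewrite mxE.
exact: (forallP (lev_pospart v) i).
Qed.

Lemma pospart_sqrD v g :
  dotv (pospart (v + g)) (pospart (v + g)) <=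
  dotv (pospart v + g) (pospart v + g).
Proof.
apply: ler_sum => i _; rewrite !mxE -!expr2.
by case: (lerP (v 0 i + g 0 i) 0); case: (lerP (v 0 i) 0); nra.
Qed.

(** Since the inverse of 0 is 0, this unit vector degenerates to 0 when [v] has no
    positive entry; it remains an admissible query, and [dotv_pospart] holds. *)
Definition posdir v : 'rV[R]_n := (enorm (pospart v))^-1 *: pospart v.

Lemma posdir_ge0 v : lev 0 (posdir v).
Proof.
apply/forallP => i; rewrite !mxE mulr_ge0 ?invr_ge0 ?enorm_ge0//.
by rewrite le_max lexx orbT.
Qed.

Lemma enorm_posdir v : enorm (posdir v) <= 1.
Proof.
rewrite enormZ ger0_norm ?invr_ge0 ?enorm_ge0//.
have [->|v0] := eqVneq (enorm (pospart v)) 0; first by rewrite mulr0 ler01.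
by rewrite mulVf.
Qed.

Lemma dotv_pospart v g :
  dotv (pospart v) g = enorm (pospart v) * dotv (posdir v) g.
Proof.
have [v0|v0] := eqVneq (enorm (pospart v)) 0.
  by rewrite v0 mul0r (enorm_eq0 v0) dotv0l.
by rewrite dotvZl mulrA divff// mul1r.
Qed.

(** Blackwell's estimate. Adding to [v] a vector almost orthogonal to its
    positive part, or pointing backwards, increases the length of that part by
    Pythagoras only: the lengths grow like the square root of the number of
    steps, up to the sum of the errors [e]. *)
Lemma pospart_growth v g a e G (k : nat) :
  0 <= a -> 0 <= e -> 0 <= G -> dotv (posdir v) g <= e -> enorm g <= G ->
  enorm (pospart v) <= a + G * Num.sqrt k%:R ->
  enorm (pospart (v + g)) <= a + e + G * Num.sqrt k.+1%:R.
Proof.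
move=> a0 e0 G0 vg; rewrite enorm_le// => gG vk.
set s := Num.sqrt k%:R in vk *; set s' := Num.sqrt k.+1%:R.
have s0 : 0 <= s by exact: sqrtr_ge0.
have s'0 : 0 <= s' by exact: sqrtr_ge0.
have ss' : s'^+2 = s^+2 + 1 by rewrite !sqr_sqrtr ?ler0n// natr1.
have s_le : s <= s' by rewrite ler_sqrt ?ler_nat.
have as0 : 0 <= a + e + G * s' by rewrite !addr_ge0// mulr_ge0.
rewrite enorm_le//; apply: le_trans (pospart_sqrD v g) _.
rewrite !dotvE (dotvC g) (dotv_pospart v g) -(enorm_sqr (pospart v)).
have := enorm_ge0 (pospart v).
set N := enorm (pospart v) in vk *; set r := dotv (posdir v) g in vg *.
set q := dotv g g in gG * => N0.
have h1 : N * r <= N * e by rewrite ler_wpM2l.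
have h2 : (N + e) ^+ 2 <= (a + e + G * s) ^+ 2.
  have Gs0 : 0 <= G * s by rewrite mulr_ge0.
  by rewrite ler_pXn2r// ?nnegrE; lra.
have h3 : (a + e) * G * s <= (a + e) * G * s'.
  by rewrite ler_wpM2l// mulr_ge0// addr_ge0.
have h4 : (G * s') ^+ 2 = (G * s) ^+ 2 + G ^+ 2 by rewrite !exprMn ss'; ring.
have e2 : 0 <= e ^+ 2 := sqr_ge0 _.
rewrite !sqrrD h4 in h2 *; lra.
Qed.

End PositivePart.

(** * Bilinear payoffs *)

Section Payoff.
Context {R : realType} {n m d : nat}.
Variable ell : {bilinear 'rV[R]_n -> 'rV[R]_m -> 'rV[R]_d}.
Implicit Types (x u : 'rV[R]_n) (y : 'rV[R]_m) (w : 'rV[R]_d).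

(** The matrix game played along the direction [w]. *)
Definition payoff w : 'M[R]_(n, m) :=
  \matrix_(i, j) dotv w (ell (delta_mx 0 i) (delta_mx 0 j)).

Lemma bilinear_sum x y :
  ell x y = \sum_i \sum_j (x 0 i * y 0 j) *: ell (delta_mx 0 i) (delta_mx 0 j).
Proof.
rewrite {1}(row_sum_delta x) linear_sumlz; apply: eq_bigr => i _.
rewrite linearZl_LR {1}(row_sum_delta y) linear_sumr scaler_sumr.
by apply: eq_bigr => j _; rewrite linearZr_LR scalerA.
Qed.

Lemma payoff_rowE w x y : dotv w (ell x y) = dotv (x *m payoff w) y.
Proof.
rewrite dotvC bilinear_sum dotv_suml.
under eq_bigr => i _ do rewrite dotv_suml.
rewrite exchange_big; apply: eq_bigr => j _ /=; rewrite mxE big_distrl /=.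
by apply: eq_bigr => i _; rewrite dotvZl dotvC mxE; ring.
Qed.

Lemma dotv_mulmx (M : 'M[R]_(n, m)) x y :
  dotv (x *m M) y = dotv x (y *m M^T).
Proof.
rewrite /dotv; under eq_bigr => j _ do rewrite mxE big_distrl /=.
rewrite exchange_big; apply: eq_bigr => i _ /=; rewrite mxE big_distrr /=.
by apply: eq_bigr => j _; rewrite mxE; ring.
Qed.

Lemma payoff_colE w x y : dotv w (ell x y) = dotv x (y *m (payoff w)^T).
Proof. by rewrite payoff_rowE dotv_mulmx. Qed.

Definition magnitude : R :=
  \sum_i \sum_j enorm (ell (delta_mx 0 i) (delta_mx 0 j)).

Lemma magnitude_ge0 : 0 <= magnitude.
Proof. by apply: sumr_ge0 => i _; apply: sumr_ge0 => j _; exact: enorm_ge0. Qed.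

Lemma enorm_mulmx p q (M : 'M[R]_(p, q)) (v : 'rV[R]_p) :
  enorm (v *m M) <= enorm v * \sum_i \sum_j `|M i j|.
Proof.
rewrite exchange_big big_distrr /=; apply: le_trans (enorm_le_sum _) _.
apply: ler_sum => j _; rewrite mxE big_distrr /=.
apply: le_trans (ler_norm_sum _ _ _) _; apply: ler_sum => i _.
by rewrite normrM ler_wpM2r// norm_coord_le.
Qed.

Lemma payoff_le w : \sum_i \sum_j `|payoff w i j| <= enorm w * magnitude.
Proof.
rewrite big_distrr; apply: ler_sum => i _ /=; rewrite big_distrr.
apply: ler_sum => j _ /=; rewrite mxE ler_norml lerNl -dotvNl.
by rewrite -{1}(enormN w) !cauchy_schwarz.
Qed.

Lemma enorm_payoff_row w x :
  enorm (x *m payoff w) <= enorm x * (enorm w * magnitude).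
Proof.
apply: le_trans (enorm_mulmx _ _) _.
by rewrite ler_wpM2l ?enorm_ge0 ?payoff_le.
Qed.

Lemma enorm_payoff_col w y :
  enorm (y *m (payoff w)^T) <= enorm y * (enorm w * magnitude).
Proof.
apply: le_trans (enorm_mulmx _ _) _; rewrite ler_wpM2l ?enorm_ge0//.
rewrite exchange_big.
apply: le_trans (payoff_le w); apply: ler_sum => i _; apply: ler_sum => j _.
by rewrite mxE.
Qed.

Lemma enorm_bilinear x y :
  enorm (ell x y) <= enorm x * magnitude * enorm y.
Proof.
have [->|e0] := eqVneq (enorm (ell x y)) 0.
  by rewrite !mulr_ge0 ?enorm_ge0 ?magnitude_ge0.
have e_gt0 : 0 < enorm (ell x y) by rewrite lt0r e0 enorm_ge0.
rewrite -(ler_pM2l e_gt0) -expr2 enorm_sqr payoff_rowE.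
apply: le_trans (cauchy_schwarz _ _) _.
rewrite mulrA ler_wpM2r ?enorm_ge0// mulrA.
by apply: le_trans (enorm_payoff_row _ _) _; rewrite mulrCA mulrA.
Qed.

Hypothesis ell_ge0 : forall x y, lev 0 x -> lev 0 y -> lev 0 (ell x y).

Lemma payoff_ge0 w i j : lev 0 w -> 0 <= payoff w i j.
Proof.
have delta_ge0 p (k : 'I_p) : lev 0 (delta_mx 0 k : 'rV[R]_p).
  by apply/forallP => l; rewrite !mxE ler0n.
by move=> w0; rewrite mxE; apply: dotv_ge0 => //; exact: ell_ge0.
Qed.

Lemma payoff_row_ge0 w x : lev 0 w -> lev 0 x -> lev 0 (x *m payoff w).
Proof.
move=> w0 /forallP x0; apply/forallP => j; rewrite !mxE.
apply: sumr_ge0 => i _; rewrite mulr_ge0 ?payoff_ge0//.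
by have := x0 i; rewrite mxE.
Qed.

Lemma payoff_col_ge0 w y : lev 0 w -> lev 0 y -> lev 0 (y *m (payoff w)^T).
Proof.
move=> w0 /forallP y0; apply/forallP => j; rewrite !mxE.
apply: sumr_ge0 => i _; rewrite mulr_ge0//; first by have := y0 i; rewrite mxE.
by rewrite mxE payoff_ge0.
Qed.

(** ** Approachability forces every half-space *)

Lemma continuous_payoff w y : continuous (fun x => dotv w (ell x y)).
Proof.
have -> : (fun x => dotv w (ell x y)) = (fun x => dotv x (y *m (payoff w)^T)).
  by apply/funext => x; rewrite payoff_colE.
by apply: continuous_dotv => x; [exact: cvg_id|exact: cst_continuous].
Qed.

Lemma best_response (Y : set 'rV[R]_m) w x : Y !=set0 -> compact Y ->
  exists2 y, Y y & forall y', Y y' -> dotv w (ell x y') <= dotv w (ell x y).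
Proof.
move=> Y0 cY; have /(compact_EVT_max Y0 cY)[y /set_mem Yy ymax] :
    {within Y, continuous (fun y => dotv w (ell x y))}.
  apply: continuous_subspaceT.
  have -> : (fun y => dotv w (ell x y)) = (fun y => dotv (x *m payoff w) y).
    by apply/funext => y; rewrite payoff_rowE.
  by apply: continuous_dotv => y; [exact: cst_continuous|exact: cvg_id].
by exists y => // y' /mem_set; exact: ymax.
Qed.

(** Against an approaching strategy, let the adversary always play a best
    response in the direction [w]. The average payoff nears the target set, and
    the average action of the player is nearly optimal, because the largest
    payoff along [w] is a convex function of the action. *)
Lemma approximate_halfspace_response X Y (S : set 'rV[R]_d) w (e : R) :
  convex_set X -> Y !=set0 -> compact Y -> S !=set0 -> compact S ->
  approachable ell X Y S -> 0 < e ->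
  exists2 x, X x & forall y, Y y ->
    dotv w (ell x y) <= support_function S w + e * enorm w.
Proof.
move=> cX Y0 cY S0 cS [A AS] e0.
have /choice[b bP] : forall x, exists y, Y y /\
    forall y', Y y' -> dotv w (ell x y') <= dotv w (ell x y).
  by move=> x; have [y Yy ymax] := best_response w x Y0 cY; exists y.
pose h := fix h t := if t is t'.+1 then rcons (h t') (b (A (h t'))) else [::].
pose y t := b (A (h t)).
have hE t : mkseq y t = h t by elim: t => // t IH; rewrite mkseqS IH.
have [XA] := AS y (fun t => (bP _).1).
move=> /cvgrPdist_lt /(_ e e0) [N _ /(_ N.+1 (leqnSn N))] /=.
rewrite sub0r normrN ger0_norm ?distance_ge0// => dist_lt.
set v := average_payoff ell A y N.+1 in dist_lt.
have vS_inf : has_inf [set enorm (v - q) | q in S].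
  split; first by case: S0 => s Ss; exists (enorm (v - s)), s.
  by exists 0 => _ [q _ <-]; exact: enorm_ge0.
have ev_gt0 : 0 < e - distance v S by rewrite subr_gt0.
have [_ [s Ss <-]] := inf_adherent ev_gt0 vS_inf.
rewrite -/(distance v S) [ltRHS]addrC subrK => vs.
have hX t : X (A (h t)) by rewrite -hE.
have sumX k : dilate k.+1%:R X (\sum_(t < k.+1) A (h t)).
  elim: k => [|k IH].
    by rewrite big_ord1; exists (A (h 0%N)); rewrite ?scale1r.
  by rewrite big_ord_recr; apply: dilate_addr => //; exact: (hX k.+1).
exists (N.+1%:R^-1 *: \sum_(t < N.+1) A (h t)); first exact: dilate_mean.
move=> y' Yy'; apply: (@le_trans _ _ (dotv w v)).
  rewrite linearZl_LR linear_sumlz !dotvZr ler_wpM2l ?invr_ge0//.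
  rewrite 2!(dotvC w) !dotv_suml; apply: ler_sum => t _.
  rewrite !(dotvC _ w) hE; exact: (bP _).2.
rewrite -(subrK s v) dotvDr addrC lerD ?le_support//.
apply: le_trans (cauchy_schwarz _ _) _.
by rewrite mulrC ler_wpM2r ?enorm_ge0 ?ltW.
Qed.

(** By compactness the error can be removed: this is the half-space condition
    of Blackwell's theorem. *)
Lemma halfspace_response X Y S w : positive_instance ell X Y S ->
  exists2 x, X x & forall y, Y y -> dotv w (ell x y) <= support_function S w.
Proof.
case=> -[_ cvX cX Y0 _ cY S0 _ _] _ _ cS apS.
pose B (e : R) : set 'rV[R]_n := [set x | X x /\ forall y, Y y ->
  dotv w (ell x y) <= support_function S w + e * enorm w].
have B0 e : 0 < e -> B e !=set0.
  move=> e0; have [x Xx xP] :=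
    approximate_halfspace_response w cvX Y0 cY S0 cS apS e0.
  by exists x.
pose F := filter_from [set e : R | 0 < e] B.
have FF : ProperFilter F.
  apply: filter_from_proper; last exact: B0.
  apply: filter_from_filter; first by exists 1; rewrite /= ltr01.
  move=> e f e0 f0; exists (Num.min e f); first by rewrite /= lt_min e0.
  have le_B a b : a <= b -> B a `<=` B b.
    move=> ab x [Xx xP]; split=> // y Yy; apply: le_trans (xP y Yy) _.
    by rewrite lerD2l ler_wpM2r ?enorm_ge0.
  by move=> x Bx; split; apply: le_B Bx; rewrite ge_min lexx ?orbT.
have [|x [Xx xF]] := cX F FF; first by exists 1 => [|x []]; rewrite /= ?ltr01.
exists x => // y Yy; rewrite leNgt; apply/negP => lt_y.
set g := dotv w (ell x y) - support_function S w.
have g0 : 0 < g by rewrite subr_gt0.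
pose e := (g / 2) / (1 + enorm w).
have w1 : 0 < 1 + enorm w by rewrite ltr_pwDl ?enorm_ge0.
have e0 : 0 < e by rewrite !divr_gt0.
have [||z [[_ zP] zV]] := xF (B e)
  [set z | support_function S w + g / 2 < dotv w (ell z y)].
- by exists e.
- by apply: (cvgr_gt _ (@continuous_payoff w y x)); rewrite /g; lra.
- have eE : e * (1 + enorm w) = g / 2 by rewrite divfK// gt_eqF.
  by have := zP y Yy; move: zV => /=; rewrite /g in eE *; lra.
Qed.

End Payoff.

(** * Programs that query oracles *)

Section Programs.
Context {R : realType} {n m d : nat} {QX QY : Type}.
Local Notation program := (computation R n m d QX QY).
Variable O : oracles R n m d QX QY.

Fixpoint bind A B (p : program A) (f : A -> program B) : program B :=
  match p with
  | Return a => f a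
  | AskX q k => AskX q (fun v => bind (k v) f)
  | AskY q k => AskY q (fun v => bind (k v) f)
  | AskS w k => AskS w (fun v => bind (k v) f)
  end.

(** A step that returns [inr b] ends the search early with outcome [b]; when
    the budget of steps runs out, the last state is returned. *)
Fixpoint search A B (k : nat) (step : A -> program (A + B)) (a : A) :
    program (A + B) :=
  if k is k'.+1 then
    bind (step a) (fun r =>
      match r with
      | inl a' => search k' step a'
      | inr b => Return (inr b)
      end)
  else Return (inl a).

Lemma result_bind A B (p : program A) (f : A -> program B) :
  result O (bind p f) = result O (f (result O p)).
Proof. by elim: p => //= q k ->. Qed.

Lemma queriesX_bind A B (p : program A) (f : A -> program B) :
  queriesX O (bind p f) = (queriesX O p + queriesX O (f (result O p)))%N.
Proof. by elim: p => //= q k ->. Qed.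

Lemma queriesY_bind A B (p : program A) (f : A -> program B) :
  queriesY O (bind p f) = (queriesY O p + queriesY O (f (result O p)))%N.
Proof. by elim: p => //= q k ->. Qed.

Lemma result_AskX A q (k : 'rV[R]_n -> program A) :
  result O (AskX q k) = result O (k (oracleX O q)).
Proof. by []. Qed.

Lemma result_AskY A q (k : 'rV[R]_m -> program A) :
  result O (AskY q k) = result O (k (oracleY O q)).
Proof. by []. Qed.

Lemma search_ind A B (P : nat -> A -> Prop) (Q : B -> Prop) K step a :
  P 0%N a ->
  (forall k a, (k < K)%N -> P k a ->
    match result O (step a) with inl a' => P k.+1 a' | inr b => Q b end) ->
  match result O (search K step a) with inl a' => P K a' | inr b => Q b end.
Proof.
move=> Pa PS.
suff : forall j k a, (k + j)%N = K -> P k a ->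
    match result O (search j step a) with inl a' => P K a' | inr b => Q b end.
  by move=> /(_ K 0%N a (add0n K) Pa).
elim=> [|j IH] k a' /=; first by rewrite addn0 => <-.
move=> kj Pka; rewrite result_bind.
have kK : (k < K)%N by rewrite -kj -addSnnS leq_addr.
have := PS k a' kK Pka; case: (result O (step a')) => //= a'' Pa''.
by apply: IH Pa''; rewrite addSnnS.
Qed.

Lemma queriesX_search A B K (step : A -> program (A + B)) a q :
  (forall a, (queriesX O (step a) <= q)%N) ->
  (queriesX O (search K step a) <= K * q)%N.
Proof.
move=> le_q; elim: K a => //= K IH a; rewrite queriesX_bind mulSn leq_add//.
by case: (result O (step a)) => /= [a'|//]; exact: IH.
Qed.

Lemma queriesY_search A B K (step : A -> program (A + B)) a q :
  (forall a, (queriesY O (step a) <= q)%N) ->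
  (queriesY O (search K step a) <= K * q)%N.
Proof.
move=> le_q; elim: K a => //= K IH a; rewrite queriesY_bind mulSn leq_add//.
by case: (result O (step a)) => /= [a'|//]; exact: IH.
Qed.

End Programs.

(** Packing a nonnegative vector as a query would need a proof inside programs;
    taking the positive part gives a total function that agrees on them. *)
Definition clip (R : realType) (n : nat) (v : 'rV[R]_n) : orthant R n :=
  exist _ (pospart v) (pospart_ge0 v).

Lemma val_clip (R : realType) (n : nat) (v : 'rV[R]_n) :
  lev 0 v -> val (clip v) = v.
Proof. exact: pospart_id. Qed.

(** * Blackwell's algorithm *)

Section Blackwell.
Context {R : realType} {n m d : nat} {QX QY : Type}.
Variable ell : {bilinear 'rV[R]_n -> 'rV[R]_m -> 'rV[R]_d}.
Local Notation program := (computation R n m d QX QY).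

(** The real argument of [respond] is the value of the support function of the
    target set at the direction given as its second argument. *)
Variable respond : nat -> 'rV[R]_d -> R -> program 'rV[R]_n.
Variable beta : R.

(** The action and the support point of the current round are kept until the
    adversary's move is observed, which turns them into an increment of the
    drift; they are reset to 0 in between. *)
Record state := State {
  round : nat;
  drift : 'rV[R]_d;
  action : 'rV[R]_n;
  aim : 'rV[R]_d }.

Definition blackwell : algorithm R n m d QX QY := Algorithm
  (State 0 0 0 0)
  (fun mu : state => let w := posdir (drift mu) in
    AskS w (fun s => bind (respond (round mu) w (dotv w s))
      (fun x => Return (State (round mu) (drift mu) x s, x))))
  (fun mu y => State (round mu).+1
    (drift mu + (ell (action mu) y - beta *: aim mu)) 0 0).

Variable O : oracles R n m d QX QY.

Local Notation after y t := (memory_after O blackwell (mkseq y t)).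
Local Notation plays y t := (selection O blackwell (mkseq y t)).

Let aim_after y t := oracleS O (posdir (drift (after y t))).

Lemma after_succ y t : after y t.+1 =
  State (round (after y t)).+1
    (drift (after y t) + (ell (plays y t) (y t) - beta *: aim_after y t)) 0 0.
Proof.
by rewrite mkseqS /memory_after foldl_rcons /selection/= !result_bind.
Qed.

Lemma round_after y t : round (after y t) = t.
Proof. by elim: t => // t IH; rewrite after_succ /= IH. Qed.

Lemma plays_respond y t : let w := posdir (drift (after y t)) in
  plays y t = result O (respond t w (dotv w (aim_after y t))).
Proof. by rewrite /selection /= result_bind round_after. Qed.

Lemma callsX_blackwell y T p :
  (forall t w theta, (queriesX O (respond t w theta) <= t.+1 ^ p)%N) ->
  (callsX O blackwell y T <= T ^ p.+1)%N.
Proof.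
move=> le_p; apply: (@leq_trans (\sum_(t < T) T ^ p)); last first.
  by rewrite sum_nat_const card_ord expnS.
apply: leq_sum => t _; rewrite /= queriesX_bind addn0 round_after.
by apply: leq_trans (le_p _ _ _) _; case: p {le_p} => // p; rewrite leq_exp2r.
Qed.

Lemma callsY_blackwell y T p :
  (forall t w theta, (queriesY O (respond t w theta) <= t.+1 ^ p)%N) ->
  (callsY O blackwell y T <= T ^ p.+1)%N.
Proof.
move=> le_p; apply: (@leq_trans (\sum_(t < T) T ^ p)); last first.
  by rewrite sum_nat_const card_ord expnS.
apply: leq_sum => t _; rewrite /= queriesY_bind addn0 round_after.
by apply: leq_trans (le_p _ _ _) _; case: p {le_p} => // p; rewrite leq_exp2r.
Qed.

Variables (X : set 'rV[R]_n) (Y : set 'rV[R]_m) (S : set 'rV[R]_d).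

Definition halfspace_responder (c : R) := forall t w, lev 0 w -> enorm w <= 1 ->
  let x := result O (respond t w (support_function S w)) in
  X x /\ forall y, Y y ->
    dotv w (ell x y) <= beta * support_function S w + c / Num.sqrt t.+1%:R.

Variables (c G : R).
Hypotheses (c_ge0 : 0 <= c) (G_ge0 : 0 <= G).
Hypothesis convS : convex_set S.
Hypothesis S0 : S !=set0.
Hypothesis oracleSP : linear_oracle S (oracleS O).
Hypothesis respondP : halfspace_responder c.
Hypothesis bounded_step : forall x y s, X x -> Y y -> S s ->
  enorm (ell x y - beta *: s) <= G.

(** The induction step of the bound [2 * c * sqrt T] on the sum of the errors
    [c / sqrt (t + 1)] of the rounds before [T]. *)
Lemma sum_inv_sqrt (t : nat) :
  2 * c * Num.sqrt t%:R + c / Num.sqrt t.+1%:R <= 2 * c * Num.sqrt t.+1%:R.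
Proof.
set s := Num.sqrt t%:R; set s' := Num.sqrt t.+1%:R.
have s0 : 0 <= s by exact: sqrtr_ge0.
have s'0 : 0 < s' by rewrite sqrtr_gt0.
have ss' : s' ^+ 2 = s ^+ 2 + 1 by rewrite !sqr_sqrtr ?ler0n// natr1.
suff : s'^-1 <= 2 * (s' - s) by move=> /(ler_wpM2l c_ge0); lra.
rewrite -(ler_pM2l s'0) divff ?gt_eqF//.
have := sqr_ge0 (s' - s); rewrite sqrrB; lra.
Qed.

(** The support oracle turns the half-space condition into the almost obtuse
    angle between [posdir] of the drift and the increment. *)
Lemma blackwell_invariant y T : (forall t, (t < T)%N -> Y (y t)) ->
  [/\ forall t, (t < T)%N -> X (plays y t),
      exists2 s, dilate T%:R S s &
        \sum_(t < T) ell (plays y t) (y t) = drift (after y T) + beta *: s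
    & enorm (pospart (drift (after y T))) <=
        2 * c * Num.sqrt T%:R + G * Num.sqrt T%:R].
Proof.
elim: T => [|T IH] Yy.
  split=> //.
    by exists 0; rewrite ?big_ord0 ?scaler0 ?addr0//; exact: dilate0.
  by rewrite sqrtr0 !mulr0 addr0 pospart0 enorm0.
have [t tT|Xt [s Ss sumE] drift_le] := IH; first exact/Yy/leqW.
set mu := after y T in drift_le sumE *.
have [Sa wa] := oracleSP (posdir (drift mu)).
have [XT playT] := respondP T (posdir_ge0 _) (enorm_posdir (drift mu)).
rewrite -wa -/(aim_after y T) -plays_respond in XT playT.
have YT : Y (y T) by exact: Yy.
split.
- by move=> t; rewrite ltnS leq_eqVlt => /orP[/eqP ->//|]; exact: Xt.
- exists (s + aim_after y T); first exact: dilate_addr.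
  rewrite big_ord_recr/= sumE after_succ /= -/mu scalerDr.
  by apply/rowP => i; rewrite !mxE; ring.
- rewrite after_succ /= -/mu -/(aim_after y T).
  set g := ell (plays y T) (y T) - beta *: aim_after y T.
  have eT0 : 0 <= c / Num.sqrt T.+1%:R by rewrite divr_ge0 ?sqrtr_ge0.
  have a0 : 0 <= 2 * c * Num.sqrt T%:R by rewrite !mulr_ge0 ?sqrtr_ge0.
  have wg : dotv (posdir (drift mu)) g <= c / Num.sqrt T.+1%:R.
    rewrite dotvDr dotvNr dotvZr lerBlDl; exact: playT.
  have := pospart_growth a0 eT0 G_ge0 wg (bounded_step XT YT Sa) drift_le.
  move=> /le_trans; apply; rewrite lerD2r; exact: sum_inv_sqrt.
Qed.

(** Subtracting the positive part of the drift, divided by [T], from the average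
    payoff leaves a vector below [beta] times the average of the support points,
    which lies in [S] by convexity. So the distance is at most the length of
    that positive part over [T]. *)
Lemma blackwell_within_rate y T : (0 < T)%N ->
  (forall t, (t < T)%N -> Y (y t)) ->
  within_rate ell X (dclosure (dilate beta S)) (2 * c + G) T
    (selection O blackwell) y.
Proof.
move=> T0 Yy; have [Xt [_ [s Ss <-] sumE] drift_le] := blackwell_invariant Yy.
split=> //; rewrite /average_payoff sumE.
set D := drift _ in drift_le *; set v := _ *: _.
have T_neq0 : (T%:R : R) != 0 by rewrite pnatr_eq0 -lt0n.
have vE : v = T%:R^-1 *: D + beta *: s.
  by rewrite /v scalerDr !scalerA mulrA (mulrAC _ beta) mulVf// mul1r.
have Qv : dclosure (dilate beta S) (v - T%:R^-1 *: pospart D).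
  exists (beta *: s); first by exists s.
  apply/forallP => i; have := forallP (lev_pospart D) i; rewrite vE !mxE => Di.
  by rewrite addrAC gerDr subr_le0 ler_wpM2l ?invr_ge0.
apply: le_trans (distance_le v Qv) _.
rewrite opprB addrC subrK enormZ ger0_norm ?invr_ge0//.
rewrite mulrC ler_pdivrMr ?ltr0n//; apply: le_trans drift_le _.
rewrite -mulrDl -mulrA ler_wpM2l ?addr_ge0 ?mulr_ge0//.
have s0 : 0 < Num.sqrt (T%:R : R) by rewrite sqrtr_gt0 ltr0n.
by rewrite ler_pdivlMl// -expr2 sqr_sqrtr.
Qed.

End Blackwell.

Lemma within_rate_approaches (R : realType) (n m d : nat)
    (ell : 'rV[R]_n -> 'rV[R]_m -> 'rV[R]_d) X Y Q (C : R) A :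
  (forall T, (0 < T)%N -> forall y, (forall t, (t < T)%N -> Y (y t)) ->
    within_rate ell X Q C T A y) ->
  approaches ell X Y A Q.
Proof.
move=> rate y Yy; split=> [t|].
  by have [Xt _] := rate t.+1 isT y (fun t _ => Yy t); exact: Xt.
apply: (@squeeze_cvgr _ _ _ _ (fun=> 0) (fun T => C / Num.sqrt T%:R)).
- exists 1%N => // T /= T0; rewrite distance_ge0/=.
  by have [] := rate T T0 y (fun t _ => Yy t).
- exact: cvg_cst.
- rewrite -cvg_shiftS /=.
  have -> : (fun T => C / Num.sqrt T.+1%:R) =
      (fun T => C * Num.sqrt (harmonic T)).
    by apply/funext => T; rewrite /harmonic sqrtrV.
  have : C * Num.sqrt (harmonic T) @[T --> \oo] --> C * Num.sqrt 0.
    apply: cvgM; first exact: cvg_cst.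
    by apply: (cvg_comp _ _ cvg_harmonic); exact: sqrt_continuous.
  by rewrite sqrtr0 mulr0.
Qed.

(** * Half-space responders *)

Section ApproximationOracles.
Context {R : realType} {n : nat}.
Implicit Types (K : set 'rV[R]_n) (f : orthant R n -> 'rV[R]_n).

Lemma approx_min_oracleP alpha K f c u :
  approx_min_oracle alpha K f -> 0 <= alpha -> K `<=` [set x | lev 0 x] ->
  lev 0 c -> K u -> K (f (clip c)) /\ dotv (f (clip c)) c <= alpha * dotv u c.
Proof.
move=> /(_ (clip c)) + alpha0 K0 c0 Ku; rewrite val_clip// => -[Kf f_le].
split=> //; apply: le_trans f_le _; rewrite ler_wpM2l//.
apply: ge_inf; last by exists u.
by exists 0 => _ [x Kx <-]; rewrite dotv_ge0// K0.
Qed.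

Lemma approx_max_oracleP alpha K f r D c v :
  approx_max_oracle alpha K f -> 0 <= alpha -> bounded_by r D K ->
  lev 0 c -> K v -> K (f (clip c)) /\ alpha * dotv v c <= dotv (f (clip c)) c.
Proof.
move=> /(_ (clip c)) + alpha0 [Kr _] c0 Kv; rewrite val_clip// => -[Kf f_ge].
split=> //; apply: le_trans f_ge; rewrite ler_wpM2l//.
apply: ub_le_sup; last by exists v.
exists (r * enorm c) => _ [x Kx <-]; apply: le_trans (cauchy_schwarz _ _) _.
by rewrite ler_wpM2r ?enorm_ge0// Kr.
Qed.

End ApproximationOracles.

Section GradientResponder.
Context {R : realType} {n m d : nat}.
Variable ell : {bilinear 'rV[R]_n -> 'rV[R]_m -> 'rV[R]_d}.

(** Online gradient ascent over [Y] with steps of length of order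
    [1 / sqrt (t + 1)]. The state holds the current point of [Y] and the sum of
    the answers of the oracle of [X]. The search never ends early, which the
    empty type of outcomes records. *)
Definition gradient_responder (t : nat) (w : 'rV[R]_d) (theta : R) :
    computation R n m d (orthant R n) 'rV[R]_m 'rV[R]_n :=
  let M := payoff ell w in
  let eta := (Num.sqrt t.+1%:R)^-1 in
  let step (yx : 'rV[R]_m * 'rV[R]_n) :=
    AskX (clip (yx.1 *m M^T)) (fun p =>
    AskY (yx.1 + eta *: (p *m M)) (fun y =>
    Return (inl (y, yx.2 + p)))) in
  AskY 0 (fun y0 => bind (search t.+1 step (y0, 0))
    (fun r : 'rV[R]_m * 'rV[R]_n + void =>
      match r with
      | inl yx => Return (t.+1%:R^-1 *: yx.2)
      | inr b => match b with end
      end)).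

Lemma queriesX_gradient_responder O t w theta :
  (queriesX O (gradient_responder t w theta) <= t.+1)%N.
Proof.
rewrite /gradient_responder; cbn -[search bind]; rewrite queriesX_bind.
apply: (@leq_trans (t.+1 * 1 + 0)); last by rewrite muln1 addn0.
apply: leq_add; first exact: queriesX_search.
by case: (result O _).
Qed.

Hypothesis ell_ge0 : forall x y, lev 0 x -> lev 0 y -> lev 0 (ell x y).

(** The regret of gradient ascent bounds the total payoff of the answers against
    a fixed [y] by their total payoff against the iterates. The latter is at
    most [alpha] times the support function per step, because the oracle
    competes with the exact half-space response. *)
Lemma gradient_responderP (RX DX RY DY alpha : R) X Y S O :
  1 <= alpha -> positive_instance ell X Y S ->
  bounded_by RX DX X -> bounded_by RY DY Y ->
  approx_min_oracle alpha X (oracleX O) -> projection_oracle Y (oracleY O) ->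
  halfspace_responder ell gradient_responder alpha O X Y S
    ((DY ^+ 2 + (RX * magnitude ell) ^+ 2) / 2).
Proof.
move=> alpha1 inst [Xr _] [_ Yd] OX OY t w w0 w1.
have [[X0 cvX _ _ cvY _ _ _ _] Xpos Ypos _ _] := inst.
have [u Xu uP] := halfspace_response w inst.
set theta := support_function S w in uP *.
have alpha0 : 0 <= alpha by rewrite (le_trans ler01).
set G := RX * magnitude ell; set M := payoff ell w in uP *.
have MG p : X p -> enorm (p *m M) <= G.
  move=> Xp; apply: le_trans (enorm_payoff_row _ _ _) _.
  apply: ler_pM; rewrite ?enorm_ge0 ?mulr_ge0 ?enorm_ge0 ?magnitude_ge0 ?Xr//.
  by rewrite -[leRHS]mul1r ler_wpM2r ?magnitude_ge0.
set s := Num.sqrt t.+1%:R.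
have s0 : 0 < s by rewrite sqrtr_gt0.
rewrite /gradient_responder; cbv zeta; rewrite -/M -/s result_AskY result_bind.
set step := fun yx : _ * _ => AskX _ _; set y0 := oracleY O 0.
have Yy0 : Y y0 := (OY 0).1.
(* The telescoped regret inequality, with the squared distance from the
   current iterate to [y] as potential. *)
pose P (k : nat) (yx : 'rV[R]_m * 'rV[R]_n) := [/\ Y yx.1, dilate k%:R X yx.2 &
  forall y, Y y ->
    2 * s^-1 * dotv (yx.2 *m M) y + dotv (yx.1 - y) (yx.1 - y) <=
    DY ^+ 2 + k%:R * (s^-1 ^+ 2 * G ^+ 2 + 2 * s^-1 * (alpha * theta))].
have DY0 : 0 <= DY by apply: le_trans (Yd _ _ Yy0 Yy0); exact: enorm_ge0.
have P0 : P 0%N (y0, 0).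
  split=> //=; first exact: dilate0.
  by move=> y Yy; rewrite mul0mx dotv0l mulr0 mul0r addr0 add0r -enorm_le// Yd.
have PS k yx : (k < t.+1)%N -> P k yx ->
    match result O (step yx) with inl a => P k.+1 a | inr b => False end.
  case: yx => y x _ [/= Yy Xx yx_le].
  have yM0 : lev 0 (y *m M^T) by apply: payoff_col_ge0 => //; exact: Ypos.
  have [Xp p_le] := approx_min_oracleP OX alpha0 Xpos yM0 Xu.
  set p := oracleX O _ in Xp p_le *.
  have y'P := projection_closer (y + s^-1 *: (p *m M)) cvY OY.
  split=> /=; [exact: (OY _).1 | exact: dilate_addr | move=> v Yv].
  have := y'P _ Yv; set y' := oracleY O _.
  have -> : y + s^-1 *: (p *m M) - v = (y - v) - (- s^-1) *: (p *m M).
    by apply/rowP => i; rewrite !mxE; ring.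
  rewrite dotv_sqr_step mulmxDl (dotvDl (x *m M)) sqrrN.
  have := yx_le v Yv; have := MG p Xp; rewrite enorm_le; last first.
    by apply: le_trans (MG _ Xp); exact: enorm_ge0.
  have si0 : 0 < s^-1 by rewrite invr_gt0.
  move=> /(ler_wpM2l (sqr_ge0 s^-1)).
  have : dotv (p *m M) y <= alpha * theta.
    rewrite dotv_mulmx; apply: le_trans p_le _; rewrite ler_wpM2l//.
    by rewrite -payoff_colE uP.
  move=> /(ler_wpM2l (ltW si0)).
  rewrite (dotvC (y - v) (p *m M)) (dotvDr y _ (p *m M)) dotvNr.
rewrite -(natr1 k); lra.
have := search_ind (step := step) (Q := fun=> False) P0 PS.
case: (result O (search _ _ _)) => // -[y x] [_ Xx x_le].
split; first exact: dilate_mean.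
move=> v Yv /=; rewrite payoff_rowE -/M -scalemxAl dotvZl.
have := x_le v Yv => /=; set q := dotv (y - v) _.
have q0 : 0 <= q by exact: dotvv_ge0.
set X1 := dotv (x *m M) v.
have <- : s ^+ 2 = t.+1%:R by rewrite sqr_sqrtr.
(* With [s ^+ 2] steps of size [s^-1], both terms of the regret bound are of
   order [s], hence of order [s^-1] after averaging. *)
move=> h; rewrite -(ler_pM2l (_ : 0 < 2 * s)) ?mulr_gt0//.
have -> : 2 * s * ((s ^+ 2)^-1 * X1) = 2 * s^-1 * X1.
  by field; rewrite gt_eqF.
have -> : 2 * s * (alpha * theta + (DY ^+ 2 + G ^+ 2) / 2 / s) =
    DY ^+ 2 + s ^+ 2 * (s^-1 ^+ 2 * G ^+ 2 + 2 * s^-1 * (alpha * theta)).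
  by field; rewrite gt_eqF.
by apply: le_trans h; rewrite lerDl.
Qed.

End GradientResponder.

Section DescentResponder.
Context {R : realType} {n m d : nat} {QX : Type}.
Variable ell : {bilinear 'rV[R]_n -> 'rV[R]_m -> 'rV[R]_d}.
Local Notation program := (computation R n m d QX (orthant R m)).

(** An approximation oracle cannot tell [X] from [alpha X], so [z] is located up
    to that factor: the cuts separate [z] from [alpha X] only, while the points
    that [z] almost dominates are in [X]. Nonnegative directions suffice for
    domination because the payoffs have nonnegative coefficients. *)
Definition locates (O : oracles R n m d QX (orthant R m)) (X : set 'rV[R]_n)
    (alpha eps rho r : R)
    (locate : 'rV[R]_n -> program ('rV[R]_n + 'rV[R]_n)) :=
  forall z, enorm z <= r ->
    match result O (locate z) with
    | inl v => enorm v <= 1 /\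
        forall u, X u -> eps <= dotv (z - alpha *: u) v
    | inr x => X x /\ forall c, lev 0 c -> dotv (x - z) c <= rho * enorm c
    end.

Variables (alpha E G H : R).
Variable locate : nat -> 'rV[R]_n -> program ('rV[R]_n + 'rV[R]_n).

(** The constants [E] and [H] are the margin and the slack of [locate], both
    rescaled by [sqrt (t + 1)]; [G] bounds the length of all cuts. *)
Definition descent_responder (t : nat) (w : 'rV[R]_d) (theta : R) :
    program 'rV[R]_n :=
  let M := payoff ell w in
  let eps := E / Num.sqrt t.+1%:R in
  let rho := H / Num.sqrt t.+1%:R in
  let tau := eps / G ^+ 2 in
  let step (z : 'rV[R]_n) :=
    bind (locate t z) (fun l =>
      match l with
      | inl v => Return (inl (z - tau *: v))
      | inr x => AskY (clip (x *m M)) (fun q => Return (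
          if dotv x (q *m M^T) <= alpha * theta + (eps + rho * G) then inr x
          else inl (z - tau *: (q *m M^T))))
      end) in
  bind (search t.+1 step 0) (fun r : 'rV[R]_n + 'rV[R]_n =>
    Return (match r with inl z => z | inr x => x end)).

Lemma queriesX_descent_responder O t w theta q :
  (forall z, (queriesX O (locate t z) <= q)%N) ->
  (queriesX O (descent_responder t w theta) <= t.+1 * q)%N.
Proof.
move=> le_q; rewrite /descent_responder; cbv zeta; rewrite queriesX_bind addn0.
apply: queriesX_search => z; rewrite queriesX_bind -[leqRHS]addn0 leq_add//.
by case: (result O (locate t z)).
Qed.

Lemma queriesY_descent_responder O t w theta :
  (forall z, queriesY O (locate t z) = 0%N) ->
  (queriesY O (descent_responder t w theta) <= t.+1)%N.
Proof.
move=> Y0; rewrite /descent_responder; cbv zeta; rewrite queriesY_bind addn0.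
rewrite -[leqRHS]muln1; apply: queriesY_search => z.
by rewrite queriesY_bind Y0; case: (result O (locate t z)).
Qed.

(** A step of length [tau] along the cut gains [2 * tau * eps] and loses at most
    [tau ^+ 2 * G ^+ 2]; the value of [tau] used here maximizes the difference. *)
Lemma cut_closer (z u v : 'rV[R]_n) eps :
  0 <= eps -> 0 < G -> enorm v <= G -> eps <= dotv (z - u) v ->
  dotv (z - (eps / G ^+ 2) *: v - u) (z - (eps / G ^+ 2) *: v - u) <=
  dotv (z - u) (z - u) - eps ^+ 2 / G ^+ 2.
Proof.
move=> eps0 G0 vG cut; rewrite (addrAC z) dotv_sqr_step.
move: vG; rewrite enorm_le ?(ltW G0)// => vG.
set q := eps / G ^+ 2; have q0 : 0 <= q by rewrite divr_ge0// sqr_ge0.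
have -> : eps ^+ 2 / G ^+ 2 = q * eps by rewrite /q expr2 mulrAC.
have q2 : q ^+ 2 * G ^+ 2 = q * eps.
  by rewrite (expr2 q) -mulrA divfK// expf_neq0// gt_eqF.
have := ler_wpM2l q0 cut; have := ler_wpM2l (sqr_ge0 q) vG; lra.
Qed.

Hypothesis ell_ge0 : forall x y, lev 0 x -> lev 0 y -> lev 0 (ell x y).

(** The potential is the squared distance from the iterate to [alpha *: u],
    where [u] is the exact half-space response. A response [q] of the adversary
    with a large payoff against [x] is a cut because [z] almost dominates [x]
    while [alpha *: u] has payoff at most [alpha * theta]; a response with a
    small payoff bounds the payoff of [x] against all of [Y]. *)
Lemma descent_responderP (RX DX RY DY alphaY : R) X Y S O :
  1 <= alpha -> 0 < alphaY <= 1 -> 1 <= G -> RY * magnitude ell <= G ->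
  E = G * (alpha * RX + 1) -> 0 <= H ->
  positive_instance ell X Y S -> bounded_by RX DX X -> bounded_by RY DY Y ->
  (forall t, locates O X alpha (E / Num.sqrt t.+1%:R) (H / Num.sqrt t.+1%:R)
    (2 * (alpha * RX)) (locate t)) ->
  approx_max_oracle alphaY Y (oracleY O) ->
  halfspace_responder ell descent_responder (alpha * alphaY^-1) O X Y S
    (alphaY^-1 * (E + H * G)).
Proof.
move=> alpha1 /andP[alphaY0 _] G1 YG defE H0 inst Xb Yb OX OY t w w0 w1.
have [Xr _] := Xb; have [Yr _] := Yb.
have [[_ _ _ [y0 Yy0] _ _ _ _ _] Xpos Ypos _ _] := inst.
have [u Xu uP] := halfspace_response w inst.
set theta := support_function S w in uP *.
have alpha0 : 0 <= alpha by rewrite (le_trans ler01).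
have G0 : 0 < G by rewrite (lt_le_trans ltr01).
have RX0 : 0 <= alpha * RX.
  by rewrite mulr_ge0//; apply: le_trans (Xr _ Xu); exact: enorm_ge0.
have E0 : 0 <= E by rewrite defE mulr_ge0 ?addr_ge0// ltW.
set M := payoff ell w in uP *.
have MG q : Y q -> enorm (q *m M^T) <= G.
  move=> Yq; apply: le_trans (enorm_payoff_col _ _ _) _; apply: le_trans YG.
  apply: ler_pM; rewrite ?enorm_ge0 ?mulr_ge0 ?enorm_ge0 ?magnitude_ge0 ?Yr//.
  by rewrite -[leRHS]mul1r ler_wpM2r ?magnitude_ge0.
have OXt := OX t.
rewrite /descent_responder; cbv zeta; rewrite -/M result_bind.
set s := Num.sqrt t.+1%:R in OXt *.
have s0 : 0 < s by rewrite sqrtr_gt0.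
set eps := E / s in OXt *; set rho := H / s in OXt *.
have eps0 : 0 <= eps by rewrite divr_ge0// ltW.
set step := fun z => bind (locate t z) _.
pose U := alpha *: u.
pose P (k : nat) (z : 'rV[R]_n) : Prop :=
  dotv (z - U) (z - U) <= (alpha * RX) ^+ 2 - k%:R * (eps ^+ 2 / G ^+ 2).
pose Q x := X x /\ forall y, Y y ->
  alphaY * dotv (x *m M) y <= alpha * theta + (eps + rho * G).
have UR : enorm U <= alpha * RX.
  by rewrite enormZ ger0_norm// ler_wpM2l// Xr.
have P0 : P 0%N (0 : 'rV[R]_n).
  by rewrite /P mul0r subr0 sub0r -enorm_le// enormN.
have PS k z : (k < t.+1)%N -> P k z ->
    match result O (step z) with inl a => P k.+1 a | inr b => Q b end.
  move=> _ Pkz; rewrite /step result_bind.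
  have zU : enorm (z - U) <= alpha * RX.
    rewrite enorm_le//; apply: le_trans Pkz _; rewrite gerBl mulr_ge0//.
    by rewrite divr_ge0 ?sqr_ge0.
  have zR : enorm z <= 2 * (alpha * RX).
    by have := enormD (z - U) U; rewrite subrK; lra.
  have cutP v : enorm v <= G -> eps <= dotv (z - U) v ->
      P k.+1 (z - (eps / G ^+ 2) *: v).
    move=> vG cut; apply: le_trans (cut_closer eps0 G0 vG cut) _.
    by move: Pkz; rewrite /P -(natr1 k); lra.
  have := OXt z zR; case: (result O (locate t z)) => [v [v1 cut]|x [Xx xz]].
    by apply: cutP (cut u Xu); exact: le_trans G1.
  have xM0 : lev 0 (x *m M) by apply: payoff_row_ge0 => //; exact: Xpos.
  rewrite result_AskY; set q := oracleY O _.
  have Yq : Y q := (OY (clip (x *m M))).1.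
  rewrite [result _ _]/=; case: ifPn => [le_thr|].
    split=> // y Yy; have [_] := approx_max_oracleP OY (ltW alphaY0) Yb xM0 Yy.
    rewrite (dotvC y) (dotvC (oracleY O _)) -/q => /le_trans; apply.
    by rewrite dotv_mulmx.
  rewrite -ltNge => gt_thr; apply: cutP; first exact: MG.
  have qM0 : lev 0 (q *m M^T) by apply: payoff_col_ge0 => //; exact: Ypos.
  have := xz _ qM0; have : rho * enorm (q *m M^T) <= rho * G.
    by rewrite ler_wpM2l ?MG// divr_ge0// ltW.
  have := ler_wpM2l alpha0 (uP q Yq); rewrite payoff_colE -/M.
  move: gt_thr; rewrite (dotvDl x) (dotvDl z) !dotvNl dotvZl; lra.
have := search_ind (step := step) (Q := Q) P0 PS.
case: (result O (search _ _ _)) => [z|x [Xx xP]].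
  (* The choice of [E] makes [t.+1] cuts cost more than the initial potential,
     so the search cannot run out of steps. *)
  rewrite /P => zU; exfalso; have := le_trans (dotvv_ge0 _) zU.
  have -> : t.+1%:R * (eps ^+ 2 / G ^+ 2) = (alpha * RX + 1) ^+ 2.
    have -> : t.+1%:R = s ^+ 2 by rewrite sqr_sqrtr.
    by rewrite /eps defE; field; rewrite !gt_eqF.
  by move: RX0; set a := alpha * RX; nra.
split=> // y Yy /=; rewrite payoff_rowE -/M.
have := xP y Yy; rewrite -(ler_pM2l (_ : 0 < alphaY^-1)) ?invr_gt0//.
rewrite mulKf ?gt_eqF// => /le_trans; apply; rewrite le_eqVlt; apply/orP; left.
by apply/eqP; rewrite /eps /rho; field; rewrite !gt_eqF.
Qed.

End DescentResponder.

Section Locate.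
Context {R : realType} {n m d : nat}.
Variable E : R.

(** The state [D] is the sum of the vectors [p - z] over the answers [p]; divided
    by their number, it compares the average answer with [z]. *)
Definition perceptron_locate (t : nat) (z : 'rV[R]_n) :
    computation R n m d (orthant R n) (orthant R m) ('rV[R]_n + 'rV[R]_n) :=
  let eps := E / Num.sqrt t.+1%:R in
  let step (D : 'rV[R]_n) := AskX (clip (posdir D)) (fun p => Return (
    if dotv (posdir D) (p - z) <= eps then inl (D + (p - z))
    else inr (- posdir D))) in
  bind (search t.+1 step 0) (fun r : 'rV[R]_n + 'rV[R]_n => Return (
    match r with inl D => inr (z + t.+1%:R^-1 *: D) | inr v => inl v end)).

Lemma queriesX_perceptron_locate O t z :
  (queriesX O (perceptron_locate t z) <= t.+1)%N.
Proof.
rewrite /perceptron_locate; cbv zeta; rewrite queriesX_bind addn0.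
by rewrite -[leqRHS]muln1; apply: queriesX_search.
Qed.

Lemma queriesY_perceptron_locate O t z :
  queriesY O (perceptron_locate t z) = 0%N.
Proof.
rewrite /perceptron_locate; cbv zeta; rewrite queriesY_bind addn0.
apply/eqP; rewrite -leqn0; apply: (@leq_trans (t.+1 * 0)).
  exact: queriesY_search.
by rewrite muln0.
Qed.

(** As long as the oracle's answers do not exceed [z] by more than [eps] along
    the direction of the positive part of [D], that part grows like the square
    root of the number of steps, so the average answer is nearly dominated by
    [z]. An answer that does exceed [z] bounds all of [alpha X] away from
    [z]. *)
Lemma perceptron_locateP (RX DX alpha : R) X O t :
  0 <= E -> 1 <= alpha -> X !=set0 -> convex_set X ->
  X `<=` [set x | lev 0 x] -> bounded_by RX DX X ->
  approx_min_oracle alpha X (oracleX O) ->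
  locates O X alpha (E / Num.sqrt t.+1%:R)
    ((E + (RX + 2 * (alpha * RX))) / Num.sqrt t.+1%:R)
    (2 * (alpha * RX)) (perceptron_locate t).
Proof.
move=> E0 alpha1 [x0 Xx0] cvX Xpos [Xr _] OX z zR.
have alpha0 : 0 <= alpha by rewrite (le_trans ler01).
set Gam := RX + _; have Gam0 : 0 <= Gam.
  have RX0 : 0 <= RX by apply: le_trans (Xr _ Xx0); exact: enorm_ge0.
  by rewrite !addr_ge0 ?mulr_ge0.
rewrite /perceptron_locate; cbv zeta; rewrite result_bind.
set s := Num.sqrt t.+1%:R.
have s0 : 0 < s by rewrite sqrtr_gt0.
set eps := E / s.
have eps0 : 0 <= eps by rewrite divr_ge0// ltW.
set step := fun D => AskX _ _.
pose P (k : nat) (D : 'rV[R]_n) : Prop := dilate k%:R X (D + k%:R *: z) /\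
  enorm (pospart D) <= k%:R * eps + Gam * Num.sqrt k%:R.
pose Q v := enorm v <= 1 /\ forall u, X u -> eps <= dotv (z - alpha *: u) v.
have P0 : P 0%N (0 : 'rV[R]_n).
  rewrite /P scale0r addr0 mul0r add0r sqrtr0 mulr0 pospart0 enorm0.
  by split=> //; apply: dilate0; exists x0.
have PS k D : (k < t.+1)%N -> P k D ->
    match result O (step D) with inl a => P k.+1 a | inr b => Q b end.
  move=> _ [XD D_le]; rewrite /step result_AskX [result _ _]/=.
  have OXu u := @approx_min_oracleP _ _ _ _ _ _ u OX alpha0 Xpos (posdir_ge0 D).
  have [Xp _] := OXu _ Xx0; set p := oracleX O _ in Xp OXu *.
  case: ifPn => [p_le|].
    split.
      have -> : D + (p - z) + k.+1%:R *: z = (D + k%:R *: z) + p.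
        by apply/rowP => i; rewrite -(natr1 k) !mxE; ring.
      exact: dilate_addr.
    have pz : enorm (p - z) <= Gam.
      by apply: le_trans (enormB _ _) _; rewrite lerD// Xr.
    have keps : 0 <= k%:R * eps by rewrite mulr_ge0.
    have := pospart_growth keps eps0 Gam0 p_le pz D_le.
    by rewrite -{2}(mul1r eps) -mulrDl natr1.
  rewrite -ltNge => lt_p; split; first by rewrite enormN enorm_posdir.
  move=> u Xu; have [_] := OXu u Xu; move: lt_p.
  rewrite dotvC (dotvDl p) dotvNr (dotvDl z) !dotvNl dotvZl; lra.
have := search_ind (step := step) (Q := Q) P0 PS.
case: (result O (search _ _ _)) => [D [XD D_le]|//].
have K0 : t.+1%:R != 0 :> R by rewrite pnatr_eq0.
split=> /=.
  have := dilate_mean (ltn0Sn t) XD.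
  by rewrite scalerDr scalerA mulVf// scale1r addrC.
move=> c c0; rewrite addrAC subrr add0r dotvZl.
apply: (@le_trans _ _ (t.+1%:R^-1 * (enorm (pospart D) * enorm c))).
  by rewrite ler_wpM2l ?invr_ge0// dotv_le_pospart.
rewrite mulrA ler_wpM2r ?enorm_ge0// ler_pdivrMl ?ltr0n//.
apply: le_trans D_le _; rewrite -/s /eps.
have -> : t.+1%:R = s ^+ 2 by rewrite sqr_sqrtr.
rewrite le_eqVlt; apply/orP; left; apply/eqP.
by field; rewrite gt_eqF.
Qed.

Definition projection_locate (t : nat) (z : 'rV[R]_n) :
    computation R n m d 'rV[R]_n (orthant R m) ('rV[R]_n + 'rV[R]_n) :=
  AskX z (fun x => Return (
    if enorm (z - x) <= E / Num.sqrt t.+1%:R then inr x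
    else inl ((enorm (z - x))^-1 *: (z - x)))).

(** When the nearest point of [X] is far from [z], the direction towards it is a
    cut, by the variational inequality. *)
Lemma projection_locateP X O t r :
  0 <= E -> convex_set X -> projection_oracle X (oracleX O) ->
  locates O X 1 (E / Num.sqrt t.+1%:R) (E / Num.sqrt t.+1%:R) r
    (projection_locate t).
Proof.
move=> E0 cvX OX z _; have [Xx xz] := OX z.
rewrite /=; set x := oracleX O z in Xx xz *.
set eps := E / _; have eps0 : 0 <= eps by rewrite divr_ge0 ?sqrtr_ge0.
case: ifPn => [x_le|].
  split=> // c _; apply: le_trans (cauchy_schwarz _ _) _.
  by rewrite ler_wpM2r ?enorm_ge0// -enormN opprB.
rewrite -ltNge => lt_x; have N0 : 0 < enorm (z - x) by exact: le_lt_trans lt_x.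
split; first by rewrite enormZ ger0_norm ?invr_ge0 ?enorm_ge0// mulVf ?gt_eqF.
move=> u Xu; rewrite scale1r dotvZr ler_pdivlMl//.
have := nearest_obtuse cvX Xx xz Xu.
have -> : u - x = (z - x) - (z - u) by apply/rowP => i; rewrite !mxE; ring.
rewrite dotvDr dotvNr (dotvC (z - u)) -enorm_sqr; nra.
Qed.

End Locate.

(** * Rates of the algorithms *)

Section Rate.
Context {R : realType} {n m d : nat} {QX QY : Type}.
Variable ell : {bilinear 'rV[R]_n -> 'rV[R]_m -> 'rV[R]_d}.

Lemma bounded_by_radius_ge0 (r D : R) (K : set 'rV[R]_n) :
  K !=set0 -> bounded_by r D K -> 0 <= r.
Proof.
by move=> [x Kx] [Kr _]; apply: le_trans (Kr _ Kx); exact: enorm_ge0.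
Qed.

Lemma ler_nat_scale (C : R) (a T p : nat) :
  1 <= C -> (a <= T ^ p)%N -> a%:R <= C * T%:R ^+ p.
Proof.
move=> C1 aT; apply: (@le_trans _ _ (T%:R ^+ p)).
  by rewrite -natrX ler_nat.
by rewrite -[leLHS]mul1r ler_wpM2r ?exprn_ge0.
Qed.

Lemma blackwell_rate respond (beta c RX DX RY DY : R) X Y S :
  0 <= c -> positive_instance ell X Y S ->
  bounded_by RX DX X -> bounded_by RY DY Y ->
  exists2 C : R, 1 <= C & forall O : oracles R n m d QX QY,
    linear_oracle S (oracleS O) ->
    halfspace_responder ell respond beta O X Y S c ->
    forall T, (0 < T)%N -> forall y, (forall t, (t < T)%N -> Y (y t)) ->
    within_rate ell X (dclosure (dilate beta S)) C T
      (selection O (blackwell ell respond beta)) y.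
Proof.
move=> c0 inst Xb Yb; have [[X0 _ _ _ _ _ S0 cvS _] _ _ cS _] := inst.
have RX0 := bounded_by_radius_ge0 X0 Xb.
have [Xr _] := Xb; have [Yr _] := Yb.
have [B SB] := compact_enorm_bounded cS.
pose G := 1 + (RX * magnitude ell * `|RY| + `|beta| * `|B|).
have F0 := magnitude_ge0 ell.
have G1 : 1 <= G by rewrite lerDl addr_ge0 ?mulr_ge0.
exists (2 * c + G); first by rewrite (le_trans G1)// lerDr mulr_ge0.
move=> O OS respP T T0 y Yy.
apply: (blackwell_within_rate c0 (le_trans ler01 G1) cvS S0 OS respP) T0 Yy.
move=> x v s Xx Yv Ss; apply: le_trans (enormB _ _) _.
apply: ler_wpDl => //; rewrite enormZ lerD ?ler_wpM2l//.
  apply: le_trans (enorm_bilinear _ _ _) _; apply: ler_pM.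
  - by rewrite mulr_ge0 ?enorm_ge0.
  - exact: enorm_ge0.
  - by rewrite ler_wpM2r// Xr.
  - by apply: le_trans (Yr _ Yv) _; exact: ler_norm.
by apply: le_trans (SB _ Ss) _; exact: ler_norm.
Qed.

End Rate.

Section Algorithms.
Context {R : realType} {n m d : nat}.
Variable ell : {bilinear 'rV[R]_n -> 'rV[R]_m -> 'rV[R]_d}.
Hypothesis ell_ge0 : forall x y, lev 0 x -> lev 0 y -> lev 0 (ell x y).
Variables (RX RY DX DY : R).
Implicit Types (X : set 'rV[R]_n) (Y : set 'rV[R]_m) (S : set 'rV[R]_d).

Definition gradient_algorithm (alphaX : R) :=
  blackwell ell (gradient_responder ell) alphaX.

Lemma gradient_algorithm_rate alphaX X Y S :
  1 <= alphaX -> positive_instance ell X Y S ->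
  bounded_by RX DX X -> bounded_by RY DY Y ->
  exists2 C : R, 1 <= C & forall O,
    approx_min_oracle alphaX X (oracleX O) ->
    projection_oracle Y (oracleY O) -> linear_oracle S (oracleS O) ->
    forall T, (0 < T)%N -> forall y, (forall t, (t < T)%N -> Y (y t)) ->
    within_rate ell X (dclosure (dilate alphaX S)) C T
      (selection O (gradient_algorithm alphaX)) y.
Proof.
move=> alphaX1 inst Xb Yb.
have c0 : 0 <= (DY ^+ 2 + (RX * magnitude ell) ^+ 2) / 2.
  by rewrite divr_ge0 ?addr_ge0 ?sqr_ge0.
have [C C1 CP] := blackwell_rate (gradient_responder ell) alphaX c0 inst Xb Yb.
exists C => // O OX OY OS; apply: CP => //.
exact: gradient_responderP Xb Yb OX OY.
Qed.

(** The bound on the length of the cuts that the descent responder meets, for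
    unit directions [w]. *)
Definition cut_bound : R := 1 + `|RY| * magnitude ell.

(** Large enough for [t.+1] cuts of depth [margin alphaX / sqrt (t + 1)] to
    exhaust the initial squared distance, at most [(alphaX * RX) ^+ 2]. *)
Definition margin (alphaX : R) : R := cut_bound * (alphaX * RX + 1).

Lemma cut_bound_ge1 : 1 <= cut_bound.
Proof. by rewrite lerDl mulr_ge0 ?magnitude_ge0. Qed.

Lemma le_cut_bound : RY * magnitude ell <= cut_bound.
Proof.
rewrite -[leLHS]add0r lerD// ler_wpM2r ?magnitude_ge0//; exact: ler_norm.
Qed.

Lemma margin_ge0 alphaX : 0 <= RX -> 0 <= alphaX -> 0 <= margin alphaX.
Proof.
move=> RX0 alphaX0; apply: mulr_ge0; first exact: le_trans ler01 cut_bound_ge1.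
by rewrite addr_ge0// mulr_ge0.
Qed.

Definition projected_descent_algorithm (alphaY : R) :=
  blackwell (QX := 'rV[R]_n) ell
    (descent_responder ell 1 (margin 1) cut_bound (margin 1)
      (projection_locate (margin 1)))
    alphaY^-1.

Lemma projected_descent_algorithm_rate alphaY X Y S :
  0 < alphaY <= 1 -> positive_instance ell X Y S ->
  bounded_by RX DX X -> bounded_by RY DY Y ->
  exists2 C : R, 1 <= C & forall O,
    projection_oracle X (oracleX O) ->
    approx_max_oracle alphaY Y (oracleY O) -> linear_oracle S (oracleS O) ->
    forall T, (0 < T)%N -> forall y, (forall t, (t < T)%N -> Y (y t)) ->
    within_rate ell X (dclosure (dilate alphaY^-1 S)) C T
      (selection O (projected_descent_algorithm alphaY)) y.
Proof.
move=> alphaY01 inst Xb Yb; have /andP[alphaY0 _] := alphaY01.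
have [[X0 cvX _ _ _ _ _ _ _] _ _ _ _] := inst.
have RX0 := bounded_by_radius_ge0 X0 Xb.
have G0 : 0 <= cut_bound by exact: le_trans ler01 cut_bound_ge1.
have E0 : 0 <= margin 1 by exact: margin_ge0.
have c0 : 0 <= alphaY^-1 * (margin 1 + margin 1 * cut_bound).
  by rewrite mulr_ge0 ?invr_ge0 ?(ltW alphaY0)// addr_ge0// mulr_ge0.
have [C C1 CP] := blackwell_rate (descent_responder ell 1 (margin 1) cut_bound
  (margin 1) (projection_locate (margin 1))) alphaY^-1 c0 inst Xb Yb.
exists C => // O OX OY OS; apply: CP => //.
rewrite -[X in halfspace_responder _ _ X]mul1r.
apply: (descent_responderP ell_ge0 (lexx 1) alphaY01 cut_bound_ge1 le_cut_bound
  erefl E0 inst Xb Yb _ OY) => t.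
exact: projection_locateP.
Qed.

(** The iterates stay within [2 * (alphaX * RX)] of the origin, so the second
    summand bounds the distance from [z] to the oracle's answers. *)
Definition slack (alphaX : R) : R :=
  margin alphaX + (RX + 2 * (alphaX * RX)).

Definition perceptron_descent_algorithm (alphaX alphaY : R) :=
  blackwell ell
    (descent_responder ell alphaX (margin alphaX) cut_bound (slack alphaX)
      (perceptron_locate (margin alphaX)))
    (alphaX * alphaY^-1).

Lemma perceptron_descent_algorithm_rate alphaX alphaY X Y S :
  1 <= alphaX -> 0 < alphaY <= 1 -> positive_instance ell X Y S ->
  bounded_by RX DX X -> bounded_by RY DY Y ->
  exists2 C : R, 1 <= C & forall O,
    approx_min_oracle alphaX X (oracleX O) ->
    approx_max_oracle alphaY Y (oracleY O) -> linear_oracle S (oracleS O) ->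
    forall T, (0 < T)%N -> forall y, (forall t, (t < T)%N -> Y (y t)) ->
    within_rate ell X (dclosure (dilate (alphaX * alphaY^-1) S)) C T
      (selection O (perceptron_descent_algorithm alphaX alphaY)) y.
Proof.
move=> alphaX1 alphaY01 inst Xb Yb; have /andP[alphaY0 _] := alphaY01.
have [[X0 cvX _ _ _ _ _ _ _] Xpos _ _ _] := inst.
have RX0 := bounded_by_radius_ge0 X0 Xb.
have G0 : 0 <= cut_bound by exact: le_trans ler01 cut_bound_ge1.
have alphaX0 : 0 <= alphaX by exact: le_trans ler01 alphaX1.
have E0 := margin_ge0 RX0 alphaX0.
have H0 : 0 <= slack alphaX by rewrite addr_ge0// addr_ge0// !mulr_ge0.
have c0 : 0 <= alphaY^-1 * (margin alphaX + slack alphaX * cut_bound).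
  by rewrite mulr_ge0 ?invr_ge0 ?(ltW alphaY0)// addr_ge0// mulr_ge0.
have [C C1 CP] := blackwell_rate (descent_responder ell alphaX (margin alphaX)
  cut_bound (slack alphaX) (perceptron_locate (margin alphaX)))
  (alphaX * alphaY^-1) c0 inst Xb Yb.
exists C => // O OX OY OS; apply: CP => //.
apply: (descent_responderP ell_ge0 alphaX1 alphaY01 cut_bound_ge1 le_cut_bound
  erefl H0 inst Xb Yb _ OY) => t.
exact: perceptron_locateP Xpos Xb OX.
Qed.

End Algorithms.

(* Each algorithm is quantified before the sets X, Y, S, hence sees them only
   through their oracles; the constant C depends neither on the horizon T, nor
   on the adversary's actions y, nor on the answers of the oracles. *)
Theorem theorem2 (R : realType) (n m d : nat)
    (ell : {bilinear 'rV[R]_n -> 'rV[R]_m -> 'rV[R]_d})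
    (ell_ge0 : forall x y, lev 0 x -> lev 0 y -> lev 0 (ell x y))
    (RX RY DX DY : R) :
  (* 1 (a) *)
  (forall alphaX : R, 1 <= alphaX ->
    (exists alg : algorithm R n m d (orthant R n) 'rV[R]_m,
      forall X Y S, positive_instance ell X Y S ->
      bounded_by RX DX X -> bounded_by RY DY Y ->
      forall O : oracles R n m d (orthant R n) 'rV[R]_m,
      approx_min_oracle alphaX X (oracleX O) ->
      projection_oracle Y (oracleY O) -> linear_oracle S (oracleS O) ->
      approaches ell X Y (selection O alg) (dclosure (dilate alphaX S)))
    /\
    (exists alg : nat -> algorithm R n m d (orthant R n) 'rV[R]_m,
      forall X Y S, positive_instance ell X Y S ->
      bounded_by RX DX X -> bounded_by RY DY Y ->
      exists C : R,
      forall O : oracles R n m d (orthant R n) 'rV[R]_m,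
      approx_min_oracle alphaX X (oracleX O) ->
      projection_oracle Y (oracleY O) -> linear_oracle S (oracleS O) ->
      forall T, (0 < T)%N ->
      forall y, (forall t, (t < T)%N -> Y (y t)) ->
      within_rate ell X (dclosure (dilate alphaX S)) C T
        (selection O (alg T)) y /\
      (callsX O (alg T) y T)%:R <= C * T%:R ^+ 2))
  /\
  (* 1 (b) *)
  (forall alphaY : R, 0 < alphaY <= 1 ->
    (exists alg : algorithm R n m d 'rV[R]_n (orthant R m),
      forall X Y S, positive_instance ell X Y S ->
      bounded_by RX DX X -> bounded_by RY DY Y ->
      forall O : oracles R n m d 'rV[R]_n (orthant R m),
      projection_oracle X (oracleX O) ->
      approx_max_oracle alphaY Y (oracleY O) -> linear_oracle S (oracleS O) ->
      approaches ell X Y (selection O alg) (dclosure (dilate alphaY^-1 S)))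
    /\
    (exists alg : nat -> algorithm R n m d 'rV[R]_n (orthant R m),
      forall X Y S, positive_instance ell X Y S ->
      bounded_by RX DX X -> bounded_by RY DY Y ->
      exists C : R,
      forall O : oracles R n m d 'rV[R]_n (orthant R m),
      projection_oracle X (oracleX O) ->
      approx_max_oracle alphaY Y (oracleY O) -> linear_oracle S (oracleS O) ->
      forall T, (0 < T)%N ->
      forall y, (forall t, (t < T)%N -> Y (y t)) ->
      within_rate ell X (dclosure (dilate alphaY^-1 S)) C T
        (selection O (alg T)) y /\
      (callsY O (alg T) y T)%:R <= C * T%:R ^+ 2))
  /\
  (* 2 *)
  (forall alphaX alphaY : R, 1 <= alphaX -> 0 < alphaY <= 1 ->
    (exists alg : algorithm R n m d (orthant R n) (orthant R m),
      forall X Y S, positive_instance ell X Y S ->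
      bounded_by RX DX X -> bounded_by RY DY Y ->
      forall O : oracles R n m d (orthant R n) (orthant R m),
      approx_min_oracle alphaX X (oracleX O) ->
      approx_max_oracle alphaY Y (oracleY O) -> linear_oracle S (oracleS O) ->
      approaches ell X Y (selection O alg)
        (dclosure (dilate (alphaX * alphaY^-1) S)))
    /\
    (exists alg : nat -> algorithm R n m d (orthant R n) (orthant R m),
      forall X Y S, positive_instance ell X Y S ->
      bounded_by RX DX X -> bounded_by RY DY Y ->
      exists C : R,
      forall O : oracles R n m d (orthant R n) (orthant R m),
      approx_min_oracle alphaX X (oracleX O) ->
      approx_max_oracle alphaY Y (oracleY O) -> linear_oracle S (oracleS O) ->
      forall T, (0 < T)%N ->
      forall y, (forall t, (t < T)%N -> Y (y t)) ->
      [/\ within_rate ell X (dclosure (dilate (alphaX * alphaY^-1) S)) C T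
            (selection O (alg T)) y,
          (callsX O (alg T) y T)%:R <= C * T%:R ^+ 3 &
          (callsY O (alg T) y T)%:R <= C * T%:R ^+ 2])).
Proof.
split; [move=> alphaX alphaX1|split].
- split.
    exists (gradient_algorithm ell alphaX) => X Y S inst Xb Yb O OX OY OS.
    have [C _ CP] := gradient_algorithm_rate ell_ge0 alphaX1 inst Xb Yb.
    by apply: (@within_rate_approaches _ _ _ _ _ _ _ _ C); exact: CP.
  exists (fun=> gradient_algorithm ell alphaX) => X Y S inst Xb Yb.
  have [C C1 CP] := gradient_algorithm_rate ell_ge0 alphaX1 inst Xb Yb.
  exists C => O OX OY OS T T0 y Yy; split; first exact: CP.
  apply: ler_nat_scale => //; apply: (callsX_blackwell _ _ _ _ (p := 1)).
  by move=> t w theta; rewrite expn1 queriesX_gradient_responder.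
- move=> alphaY alphaY01; split.
    exists (projected_descent_algorithm ell RX RY alphaY).
    move=> X Y S inst Xb Yb O OX OY OS.
    have [C _ CP] :=
      projected_descent_algorithm_rate ell_ge0 alphaY01 inst Xb Yb.
    by apply: (@within_rate_approaches _ _ _ _ _ _ _ _ C); exact: CP.
  exists (fun=> projected_descent_algorithm ell RX RY alphaY).
  move=> X Y S inst Xb Yb.
  have [C C1 CP] :=
    projected_descent_algorithm_rate ell_ge0 alphaY01 inst Xb Yb.
  exists C => O OX OY OS T T0 y Yy; split; first exact: CP.
  apply: ler_nat_scale => //; apply: (callsY_blackwell _ _ _ _ (p := 1)).
  by move=> t w theta; rewrite expn1 queriesY_descent_responder.
- move=> alphaX alphaY alphaX1 alphaY01; split.
    exists (perceptron_descent_algorithm ell RX RY alphaX alphaY).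
    move=> X Y S inst Xb Yb O OX OY OS.
    have [C _ CP] :=
      perceptron_descent_algorithm_rate ell_ge0 alphaX1 alphaY01 inst Xb Yb.
    by apply: (@within_rate_approaches _ _ _ _ _ _ _ _ C); exact: CP.
  exists (fun=> perceptron_descent_algorithm ell RX RY alphaX alphaY).
  move=> X Y S inst Xb Yb.
  have [C C1 CP] :=
    perceptron_descent_algorithm_rate ell_ge0 alphaX1 alphaY01 inst Xb Yb.
  exists C => O OX OY OS T T0 y Yy; split; first exact: CP.
    apply: ler_nat_scale => //; apply: (callsX_blackwell _ _ _ _ (p := 2)).
    move=> t w theta; rewrite expnS expn1 queriesX_descent_responder// => z.
    exact: queriesX_perceptron_locate.
  apply: ler_nat_scale => //; apply: (callsY_blackwell _ _ _ _ (p := 1)).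
  move=> t w theta; rewrite expn1 queriesY_descent_responder// => z.
  exact: queriesY_perceptron_locate.
Qed.
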